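(* Let $(X,d,\mathfrak m)$ be a metric measure space. Let $p,q\in(1,\infty)$ satisfy $\frac1p+\frac1q=1$. Let $\mathcal S$ be a separable subset of $W^{1,p}(X)$. Then there exists an $\mathcal S$-master $q$-test plan on $X$. In particular, if the Sobolev space $W^{1,p}(X)$ is separable, then there exists a master $q$-test plan on $X$.
   Context: A metric measure space $(X,d,\mathfrak m)$ is a complete and separable metric space $(X,d)$ together with a boundedly-finite Borel measure $\mathfrak m\ge 0$ (finite on bounded Borel sets). Curves. $C([0,1],X)$ is the space of continuous curves with the supremum distance $d_{\sup}(\gamma,\sigma)=\max_{t\in[0,1]}d(\gamma_t,\sigma_t)$. A curve $\gamma\in C([0,1],X)$ is absolutely continuous if the limit $|\dot\gamma_t|:=\lim_{h\to0}d(\gamma_{t+h},\gamma_t)/|h|$ exists for a.e. $t\in[0,1]$, the resulting function $|\dot\gamma|$ belongs to $L^1(0,1)$, and $d(\gamma_t,\gamma_s)\le\int_s^t|\dot\gamma_r|\,dr$ for all $s\le t$ in $[0,1]$. For $t\in[0,1]$, the evaluation map at time $t$ is $\mathsf e_t(\gamma):=\gamma_t$. $\mathcal L_1$ is the Lebesgue measure restricted to $[0,1]$. Test plans. A $q$-test plan on $X$ is a Borel probability measure $\pi$ on $C([0,1],X)$, concentrated on absolutely continuous curves, such that for some $C>0$ one has $(\mathsf e_t)_\#\pi\le C\mathfrak m$ for every $t\in[0,1]$, and $\int\int_0^1|\dot\gamma_t|^q\,dt\,d\pi(\gamma)<+\infty$. Let $\Pi_q(X)$ be the collection of all $q$-test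 plans on $X$, and set $\hat\pi:=\pi\otimes\mathcal L_1$, a probability measure on $C([0,1],X)\times[0,1]$. Weak upper gradients. Given a family $\Pi$ of $q$-test plans on $X$ and functions $f,G\in L^p(\mathfrak m)$, $G$ is a $(\Pi,p)$-weak upper gradient of $f$ if for every $\pi\in\Pi$ one has $f\circ\gamma\in W^{1,1}(0,1)$ for $\pi$-a.e. $\gamma$ and $|(f\circ\gamma)'_t|\le G(\gamma_t)|\dot\gamma_t|$ for $\hat\pi$-a.e. $(\gamma,t)\in C([0,1],X)\times[0,1]$. The set of $f\in L^p(\mathfrak m)$ admitting a $(\Pi,p)$-weak upper gradient is $W^{1,p}_\Pi(X)$. For $f\in W^{1,p}_\Pi(X)$, the minimal $(\Pi,p)$-weak upper gradient $|Df|_{\Pi,p}\in L^p(\mathfrak m)$ is defined as the essential infimum of all the $(\Pi,p)$-weak upper gradients of $f$; it itself satisfies the weak upper gradient inequality above. Sobolev space. $W^{1,p}(X):=W^{1,p}_{\Pi_q(X)}(X)$ and $|Df|_p:=|Df|_{\Pi_q(X),p}$. $W^{1,p}(X)$ is a Banach space with the norm $\|f\|_{W^{1,p}(X)}=\big(\int|f|^p\,d\mathfrak m+\int|Df|_p^p\,d\mathfrak m\big)^{1/p}$, and separability of $W^{1,p}(X)$ and of its subsets refers to this norm. One has $W^{1,p}(X)\subseteq W^{1,p}_\Pi(X)$ for every family $\Pi$ of $q$-test plans on $X$, and $|Df|_{\Pi,p}\le|Df|_p$ $\mathfrak m$-a.e. for every $f\in W^{1,p}(X)$. Master test plans. For $\mathcal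 S\subseteq W^{1,p}(X)$, a family $\Pi$ of $q$-test plans on $X$ is an $\mathcal S$-master family of $q$-test plans if $|Df|_{\Pi,p}=|Df|_p$ holds $\mathfrak m$-a.e. on $X$ for every $f\in\mathcal S$. A $q$-test plan $\pi$ is an $\mathcal S$-master $q$-test plan if $\{\pi\}$ is an $\mathcal S$-master family of $q$-test plans; it is a master $q$-test plan if this holds with $\mathcal S=W^{1,p}(X)$. (It is not required that $W^{1,p}_\Pi(X)=W^{1,p}(X)$ for a master family $\Pi$.)
   Formalization: The measure m is assumed to be nonzero; for m = 0 there is no q-test plan at all (the time marginals of a probability measure cannot be bounded by C·0), although W^{1,p}(X) = {0} is separable, so the statement fails there. *)

(* Defs.v *)
From HB Require Import structures.
From mathcomp Require Import all_boot all_order all_algebra.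
From mathcomp Require Import all_classical all_reals all_analysis.
From mathcomp Require Import lra.

Set Implicit Arguments.
Unset Strict Implicit.
Unset Printing Implicit Defensive.

Import Order.TTheory GRing.Theory Num.Theory.
Import numFieldNormedType.Exports.

Local Open Scope classical_set_scope.
Local Open Scope ring_scope.

#[short(type="completeMetricType")]
HB.structure Definition CompleteMetric (K : numDomainType) :=
  {T of Metric K T & Complete T}.

Definition borel (T : ptopologicalType) := g_sigma_algebraType (@open T).

(* Completeness is part of [completeMetricType]. *)
Definition metric_measure_space (R : realType) (X : completeMetricType R)
    (m : {measure set (borel X) -> \bar R}) : Prop :=
  (exists2 D : set X, countable D & dense D) /\
  (forall B : set (borel X), measurable B ->
    (exists (x : X) (r : R), B `<=` ball x r) -> (m B < +oo)%E).

(** * Curves *)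

Definition unit_interval (R : realType) : set R := `[0, 1]%classic.
Arguments unit_interval : clear implicits.

Definition curve (R : realType) (X : topologicalType) :=
  continuousType (unit_interval R) X.

Definition clamp01 (R : realType) (t : R) : R := Num.max 0 (Num.min 1 t).

Lemma clamp01_in (R : realType) (t : R) : clamp01 t \in unit_interval R.
Proof.
by rewrite inE /unit_interval/= in_itv/= /clamp01 le_max lexx/= ge_max ler01/= ge_min lexx.
Qed.

Definition unit_pt (R : realType) (t : R) : unit_interval R :=
  exist _ (clamp01 t) (clamp01_in t).

(* The evaluation map at time t in [0, 1].  For t outside [0, 1] it is the
   evaluation at the nearest endpoint; this convention only affects difference
   quotients at the two times 0 and 1. *)
Definition evalc (R : realType) (X : topologicalType) (t : R)
  (g : curve R X) : X := (g : continuousType _ _) (unit_pt t).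

Definition dsup (R : realType) (X : metricType R) (g h : curve R X) : R :=
  sup [set mdist ((g : continuousType _ _) t) ((h : continuousType _ _) t)
      | t in [set: unit_interval R]].

Section curve_metric.
Context {R : realType} {X : metricType R}.
Implicit Types g h k : continuousType (unit_interval R) X.

Lemma cts_mdist g h : continuous (fun t => mdist (g t) (h t) : R).
Proof.
move=> t; have FF : Filter (nbhs t) := nbhs_filter t.
apply/(@cvgrPdist_lt _ _ _ (nbhs t) FF) => e e0.
have e2 : 0 < e / 2 by rewrite divr_gt0.
have := @cts_fun _ _ g t; have := @cts_fun _ _ h t.
move=> /(@metricType_numDomainType.cvgrPdist_lt _ _ _ _ FF)/(_ _ e2) hh.
move=> /(@metricType_numDomainType.cvgrPdist_lt _ _ _ _ FF)/(_ _ e2) gg.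
near=> s; rewrite ltr_norml.
have gs : mdist (g t) (g s) < e / 2 by near: s.
have hs : mdist (h t) (h s) < e / 2 by near: s.
have := metric_triangle (g t) (g s) (h t).
have := metric_triangle (g s) (h s) (h t).
have := metric_triangle (g s) (g t) (h s).
have := metric_triangle (g t) (h t) (h s).
rewrite (metric_sym (h s) (h t)) (metric_sym (g s) (g t)).
move: gs hs => /= A B C1 C2 C3 C4; apply/andP; split; lra.
Unshelve. all: by end_near. Qed.

Lemma has_sup_mdist g h :
  has_sup [set mdist (g t) (h t) | t in [set: unit_interval R]].
Proof.
split; first by exists (mdist (g (unit_pt 0)) (h (unit_pt 0))), (unit_pt 0).
have /subspace_valL_continuousP := @cts_mdist g h.
move=> /(@EVT_max R _ 0 1 ler01)[c _ cmax].
set f := fun t => mdist (g t) (h t) in cmax *.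
exists (valL f c) => _ [t _ <-].
have t01 : set_val t \in unit_interval R by exact/mem_set/set_valP.
have := cmax (set_val t) (set_mem t01).
by rewrite -[valL f (set_val t)]/(sigL (unit_interval R) (valL f) t) valLK.
Qed.

Lemma mdist_le_dsup g h t : mdist (g t) (h t) <= dsup g h.
Proof.
by apply: sup_ubound; [have [] := has_sup_mdist g h|exists t].
Qed.

Lemma dsup_le g h (e : R) :
  (forall t, mdist (g t) (h t) <= e) -> dsup g h <= e.
Proof.
move=> ge; apply: ge_sup; first by have [] := has_sup_mdist g h.
by move=> _ [t _ <-].
Qed.

Lemma dsupxx g : dsup g g = 0.
Proof.
apply/eqP; rewrite eq_le dsup_le/=; last by move=> t; rewrite mdistxx.
by rewrite (le_trans _ (mdist_le_dsup g g (unit_pt 0)))// mdistxx.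
Qed.

Lemma dsup_positivity g h : dsup g h = 0 -> g = h.
Proof.
move=> gh0; apply/continuousEP => t; apply: (@mdist_positivity R).
by apply/eqP; rewrite eq_le mdist_ge0 andbT -gh0 mdist_le_dsup.
Qed.

Lemma dsup_sym g h : dsup g h = dsup h g.
Proof.
by apply/eqP; rewrite eq_le; apply/andP; split;
  apply: dsup_le => t; rewrite metric_sym mdist_le_dsup.
Qed.

Lemma dsup_triangle h g k : dsup g k <= dsup g h + dsup h k.
Proof.
apply: dsup_le => t; rewrite (le_trans (metric_triangle _ (h t) _))//.
by rewrite lerD ?mdist_le_dsup.
Qed.

HB.instance Definition _ := Choice.on (curve R X).
HB.instance Definition _ := @isMetric.Build R (curve R X)
  (@dsup R X) dsupxx dsup_positivity dsup_sym dsup_triangle.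

End curve_metric.

HB.instance Definition _ (R : realType) (X : completeMetricType R) :=
  isPointed.Build (curve R X)
    (mkcts (@cst_continuous (unit_interval R) X point) : continuousType _ _).

Section curves.
Context {R : realType} {X : completeMetricType R}.

Definition diff_quotient (g : curve R X) (t h : R) : R :=
  mdist (evalc (t + h) g) (evalc t g) / `|h|.

Definition metric_speed (g : curve R X) (t : R) : R :=
  lim (diff_quotient g t @ 0^').

Definition abs_continuous (g : curve R X) : Prop :=
  [/\ (\forall t \ae lebesgue_measure, t \in unit_interval R ->
        cvg (diff_quotient g t @ 0^')),
      lebesgue_measure.-integrable (unit_interval R) (EFin \o metric_speed g) &
      forall s t : R, 0 <= s -> s <= t -> t <= 1 ->
        ((mdist (evalc t g) (evalc s g))%:E <=
          \int[lebesgue_measure]_(r in `[s, t]) (metric_speed g r)%:E)%E].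

End curves.

(** * Sobolev functions on the interval (0, 1) *)

Definition test_function (R : realType) (phi : R -> R) : Prop :=
  (forall n x, derivable (derive1n n phi) x 1) /\
  exists a b : R, [/\ 0 < a, b < 1 & forall x, x \notin `[a, b] -> phi x = 0].

(* [u] is in W^{1,1}(0, 1) and [v] represents its weak derivative. *)
Definition weak_derivative (R : realType) (u v : R -> R) : Prop :=
  [/\ lebesgue_measure.-integrable `]0, 1[ (EFin \o u),
      lebesgue_measure.-integrable `]0, 1[ (EFin \o v) &
      forall phi, test_function phi ->
        \int[lebesgue_measure]_(t in `]0, 1[) (u t * derive1 phi t) =
        - \int[lebesgue_measure]_(t in `]0, 1[) (v t * phi t)].

Definition sobolev11 (R : realType) (u : R -> R) : Prop :=
  exists v, weak_derivative u v.

Lemma lebesgue_unit_lty (R : realType) :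
  (lebesgue_measure (unit_interval R) < +oo)%E.
Proof. by rewrite lebesgue_measure_itv/= lte_fin ltr01 oppr0 addr0 ltry. Qed.

(* The Lebesgue measure restricted to [0, 1]. *)
Definition lebesgue01 (R : realType) :
    {finite_measure set (measurableTypeR R) -> \bar R} :=
  @mfrestr _ (measurableTypeR R) R _ lebesgue_measure
    (measurable_itv `[(0:R), 1]) (lebesgue_unit_lty R).
Arguments lebesgue01 : clear implicits.

Section test_plans.
Context {R : realType} {X : completeMetricType R}.
Variable m : {measure set (borel X) -> \bar R}.

Definition plan := probability (borel (curve R X)) R.

Definition test_plan (q : R) (pi : plan) : Prop :=
  [/\ (\forall g \ae pi, abs_continuous (g : curve R X)),
      (exists2 C : R, 0 < C & forall t, t \in unit_interval R ->
        forall A : set (borel X), measurable A ->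
          (pushforward pi (evalc t : borel (curve R X) -> borel X) A <=
            C%:E * m A)%E) &
      (\int[pi]_g \int[lebesgue_measure]_(t in unit_interval R)
          (metric_speed g t `^ q)%:E < +oo)%E].

Definition test_plans (q : R) : set plan := [set pi | test_plan q pi].

(** * Weak upper gradients *)

(* Elements of L^p(m) are represented by Borel functions [X -> R]; all notions
   below are invariant under m-a.e. equality because (e_t)_# pi <= C m.  The
   gradients G are required to be nonnegative: otherwise G would be
   unconstrained where no curve moves, and the essential infimum of all the
   weak upper gradients could be -oo there.
   The weak derivatives of the functions [f \o g] are represented by one
   measurable function [df] of (g, t); since weak derivatives are unique up to
   null sets, [df] is unique up to [pi \x lebesgue01]-null sets. *)
Definition weak_upper_gradient (Pi : set plan) (p : R) (f G : X -> R) : Prop :=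
  [/\ (G : borel X -> R) \in Lfun m p%:E,
      (\forall x \ae m, 0 <= G x) &
      forall pi : plan, Pi pi ->
        (\forall g \ae pi, sobolev11 (fun t => f (evalc t g))) /\
        exists2 df : borel (curve R X) * R -> R,
          measurable_fun setT df /\
          (\forall g \ae pi,
            weak_derivative (fun t => f (evalc t g)) (fun t => df (g, t))) &
          \forall gt \ae (pi \x lebesgue01 R)%E,
            `|df gt| <= G (evalc gt.2 gt.1) * metric_speed gt.1 gt.2].

Definition sobolev_wrt (Pi : set plan) (p : R) : set (X -> R) :=
  [set f | (f : borel X -> R) \in Lfun m p%:E /\
           exists G, weak_upper_gradient Pi p f G].

Definition ess_infimum (F : set (X -> R)) (g : X -> R) : Prop :=
  [/\ measurable_fun [set: borel X] g,
      forall h, F h -> \forall x \ae m, g x <= h x &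
      forall g' : X -> R, measurable_fun [set: borel X] g' ->
        (forall h, F h -> \forall x \ae m, g' x <= h x) ->
        \forall x \ae m, g' x <= g x].

(* The essential infimum is unique up to m-null sets; [xget] selects one
   representative (and 0 when [f] has no weak upper gradient). *)
Definition min_weak_upper_gradient (Pi : set plan) (p : R) (f : X -> R) :
    X -> R :=
  xget (cst 0) [set g | ess_infimum (weak_upper_gradient Pi p f) g].

Definition sobolev (p q : R) : set (X -> R) := sobolev_wrt (test_plans q) p.

Definition sobolev_norm (p q : R) (f : X -> R) : \bar R :=
  ((\int[m]_x (`|f x| `^ p)%:E +
    \int[m]_x (`|min_weak_upper_gradient (test_plans q) p f x| `^ p)%:E)
   `^ p^-1)%E.

Definition sobolev_separable (p q : R) (S : set (X -> R)) : Prop :=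
  exists2 D : set (X -> R), countable D /\ D `<=` S &
    forall f, S f -> forall e : R, 0 < e ->
      exists2 g, D g & (sobolev_norm p q (fun x => (f x - g x)%R) < e%:E)%E.

(** * Master test plans *)

Definition master_family (p q : R) (S : set (X -> R)) (Pi : set plan) : Prop :=
  Pi `<=` test_plans q /\
  forall f, S f ->
    min_weak_upper_gradient Pi p f =
    min_weak_upper_gradient (test_plans q) p f %[ae m].

Definition master_test_plan (p q : R) (S : set (X -> R)) (pi : plan) : Prop :=
  master_family p q S [set pi].

End test_plans.

Arguments plan {R} X.

(* Main.v *)
Require Import Defs.
From HB Require Import structures.
From mathcomp Require Import all_boot all_order all_algebra.
From mathcomp Require Import all_classical all_reals all_analysis.
From mathcomp Require Import measurable_realfun.
From mathcomp Require Import ring lra.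

Set Implicit Arguments.
Unset Strict Implicit.
Unset Printing Implicit Defensive.

Import Order.TTheory GRing.Theory Num.Theory.
Import numFieldNormedType.Exports.

Local Open Scope classical_set_scope.
Local Open Scope ring_scope.

(** Write |Df|_P for the minimal weak upper gradient of f along a single plan
    P, and |Df| for the one along all the test plans.

    Minimal gradients are attained.  Along a plan, two weak upper gradients of
    f bound one and the same weak derivative ([weak_derivative_unique],
    [ae_eq_along]), so the pointwise infimum of countably many weak upper
    gradients is again one ([wug_inf]).  A weak upper gradient of least
    p-energy therefore exists, and by strict monotonicity of the energy
    ([Lp_energy_rigidity]) it lies below all the others; since the time
    marginals of a test plan are controlled by m, modifying a weak upper
    gradient on an m-null set is harmless ([ae_along_of_ae], [wug_ae_eq]).
    This is [min_wugP].

    Countably many test plans P_n can be merged into a single test plan, a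
    convex combination of the P_n with quickly decreasing weights
    ([mixture_test_plan]).  Each P_n is absolutely continuous with respect to
    the combination P, so a weak upper gradient along P is one along each P_n,
    and |Df|_(P_n) <= |Df|_P.

    For a single Sobolev function f, the p-energy of |Df|_P is bounded by that
    of |Df|, and by the merging property its supremum over the test plans P is
    attained, say at P.  Merging P with any other test plan Q does not
    increase the energy, hence does not change |Df|_P, which is thus a weak
    upper gradient along Q.  As Q is arbitrary, |Df| <= |Df|_P, and equality
    holds ([ex_master_single]).

    For a set S with a countable dense subset D, merging the plans obtained
    for the elements of D gives a plan P with |Dg|_P = |Dg| for all g in D.
    The estimate |Df| - |Df|_P <= 2 |D(f - g)| ([full_sub_along_le]) and the
    density of D extend the equality to S ([master_closure]). *)

(** * Smooth bump functions *)

Section flat_exponential.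
Context {R : realType}.
Implicit Types (P Q : {poly R}) (x y t : R).

(** Exponential decay beats polynomial growth; this is what makes the functions
    below differentiable at 0, to all orders. *)
Lemma horner_expRN_bounded P :
  exists C : R, forall t, 0 <= t -> `|P.[t]| * expR (- t) <= C.
Proof.
elim/poly_ind: P => [|P c _].
  by exists 0 => t _; rewrite horner0 normr0 mul0r.
suff mono n : exists C : R, forall t, 0 <= t -> t ^+ n * expR (- t) <= C.
  set Q := _ + _.
  have [C HC] := choice mono.
  exists (\sum_(i < size Q) `|Q`_i| * C i) => t t0.
  rewrite horner_coef (le_trans (ler_wpM2r (expR_ge0 _) (ler_norm_sum _ _ _)))//.
  rewrite mulr_suml; apply: ler_sum => i _.
  by rewrite normrM -mulrA ler_wpM2l// ger0_norm ?exprn_ge0// HC.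
case: n => [|n].
  by exists 1 => t t0; rewrite expr0 mul1r -expR0 ler_expR oppr_le0.
exists (n.+1)`!%:R => t t0.
rewrite expRN ler_pdivrMr ?expR_gt0// -ler_pdivrMl ?ltr0n ?fact_gt0//.
have := expR_ge1Dxn n t0; rewrite mulrC; lra.
Qed.

(** For P = 1 this is the classical smooth flat function exp(-1/x); the
    polynomial factor in 1/x makes the family stable under derivation. *)
Definition flat_expR P x : R := if 0 < x then P.[x^-1] * expR (- x^-1) else 0.

Definition flat_deriv P : {poly R} := 'X^2 * (P - P^`()).

Lemma flat_expR_le0 P x : x <= 0 -> flat_expR P x = 0.
Proof. by move=> x0; rewrite /flat_expR ltNge x0. Qed.

(** Away from 0 this is the chain rule.  At 0, the decay of the exponential
    gives a bound by C x^2, whose difference quotients vanish. *)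
Lemma is_derive_flat_expR P x :
  is_derive x 1 (flat_expR P) (flat_expR (flat_deriv P) x).
Proof.
have [x0|x0|->] := ltrgtP x 0.
- rewrite (flat_expR_le0 _ (ltW x0)).
  apply: (@near_eq_is_derive _ _ _ (cst 0)).
  near=> y; rewrite flat_expR_le0//.
  by apply/ltW; near: y; exact: lt_nbhsl.
- rewrite [flat_expR (flat_deriv P) x]/flat_expR x0.
  apply: (@near_eq_is_derive _ _ _ (fun y => P.[y^-1] * expR (- y^-1))).
    near=> y; rewrite /flat_expR ifT//.
    by near: y; exact: lt_nbhsr.
  have xN0 : x != 0 by rewrite gt_eqF.
  have dV : is_derive x 1 (fun y : R => y^-1) (- x ^- 2).
    have := is_deriveV (f := id) xN0 (is_derive_id x 1).
    by rewrite /GRing.scale/= mulr1.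
  have dP : is_derive x 1 (horner P \o (fun y => y^-1)) (P^`().[x^-1] * - x ^- 2).
    have := @is_derive1_comp _ (horner P) (fun y => y^-1) x _ _ _ dV.
    by apply; exact: is_derive_poly.
  have dE : is_derive x 1 (expR \o (fun y => - y^-1)) (expR (- x^-1) * x ^- 2).
    have dVN : is_derive x 1 (fun y : R => - y^-1) (x ^- 2).
      by have := @is_deriveN _ _ _ _ _ _ _ dV; rewrite opprK.
    exact: (@is_derive1_comp _ expR (fun y => - y^-1) x).
  have := is_deriveM dP dE.
  rewrite /flat_deriv hornerM hornerXn hornerD hornerN exprVn.
  move=> /is_derive_eq; apply.
  rewrite /GRing.scale/=; ring.
- rewrite flat_expR_le0//.
  have [C HC] := horner_expRN_bounded ('X^2 * P).
  have C0 : 0 <= C by apply: le_trans (HC 0 _) => //; rewrite mulr_ge0 ?expR_ge0.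
  have bound y : `|flat_expR P y| <= C * y ^+ 2.
    have [y0|y0] := leP y 0; first by rewrite flat_expR_le0// normr0 mulr_ge0 ?sqr_ge0.
    rewrite /flat_expR y0 normrM (ger0_norm (expR_ge0 _)).
    have yV0 : 0 <= y^-1 by rewrite invr_ge0 ltW.
    have := HC _ yV0; rewrite hornerM hornerXn normrM (ger0_norm (exprn_ge0 2 yV0)).
    by rewrite exprVn -mulrA ler_pdivrMl ?exprn_gt0// [C * _]mulrC.
  have lim0 : h^-1 *: ((flat_expR P \o shift 0) (h *: (1:R)) - flat_expR P 0)
      @[h --> 0^'] --> (0 : R).
    apply/cvgrPdist_le => e e0; near=> h.
    rewrite sub0r normrN/= addr0 (@flat_expR_le0 P 0)// subr0.
    rewrite /GRing.scale/= mulr1 normrM normfV.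
    have h0 : h != 0 by near: h; exact: nbhs_dnbhs_neq.
    rewrite ler_pdivrMl ?normr_gt0// (le_trans (bound _))//.
    rewrite -[h ^+ 2]real_normK ?num_real// expr2 mulrCA ler_pM2l ?normr_gt0//.
    apply: (@le_trans _ _ ((C + 1) * `|h|)); first by rewrite ler_wpM2r// lerDl.
    rewrite mulrC -ler_pdivlMr ?ltr_wpDl//.
    near: h; apply: dnbhs0_le; rewrite divr_gt0// ltr_wpDl//.
  apply: DeriveDef; first by apply/cvg_ex; exists 0.
  by apply/cvg_lim => //; exact: Rhausdorff.
Unshelve. all: by end_near. Qed.

(** The span, with polynomial coefficients, of the compositions of the flat
    functions with a fixed polynomial u.  The product and chain rules stay
    within this span, so that one step of derivation yields smoothness. *)
Inductive flat_span (u : {poly R}) : (R -> R) -> Prop :=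
| flat_span1 p P : flat_span u (fun x => p.[x] * flat_expR P u.[x])
| flat_spanD f g : flat_span u f -> flat_span u g ->
    flat_span u (fun x => f x + g x).

Lemma flat_span_deriv u f : flat_span u f ->
  (forall x, derivable f x 1) /\ flat_span u (derive1 f).
Proof.
elim => [p P|g h _ [dg fg] _ [dh fh]].
- have dx x : is_derive x 1 (fun x => p.[x] * flat_expR P u.[x])
     (p^`().[x] * flat_expR P u.[x] +
       (p * u^`()).[x] * flat_expR (flat_deriv P) u.[x]).
    have dF : is_derive x 1 (flat_expR P \o horner u)
        (flat_expR (flat_deriv P) u.[x] * u^`().[x]).
      apply: (@is_derive1_comp _ (flat_expR P) (horner u) x).
      exact: is_derive_flat_expR.
    have := is_deriveM (is_derive_poly p x) dF.
    move=> /is_derive_eq; apply.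
    by rewrite /GRing.scale/= hornerM; ring.
  split=> [x|]; first exact: (@ex_derive _ _ _ _ _ _ _ (dx x)).
  rewrite (_ : derive1 _ = fun x => (p^`().[x] * flat_expR P u.[x] +
       (p * u^`()).[x] * flat_expR (flat_deriv P) u.[x])).
    by apply: flat_spanD; exact: flat_span1.
  by apply/funext => x; rewrite derive1E; apply: derive_val.
- split=> [x|]; first exact: derivableD.
  rewrite (_ : derive1 _ = fun x => derive1 g x + derive1 h x).
    exact: flat_spanD.
  by apply/funext => x; rewrite !derive1E; apply: deriveD.
Qed.

Lemma flat_span_smooth u f n x : flat_span u f -> derivable (derive1n n f) x 1.
Proof.
move=> uf; suff : flat_span u (derive1n n f) by move=> /flat_span_deriv[].
by elim: n => [//|n ih]; rewrite derive1nS; exact: (flat_span_deriv ih).2.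
Qed.

Definition bump (a b : R) (k : R) x : R :=
  flat_expR 1 (k * ((x - a) * (b - x))).

Lemma test_function_bump (a b k : R) : 0 < a -> a <= b -> b < 1 -> 0 <= k ->
  test_function (bump a b k).
Proof.
move=> a0 ab b1 k0; split.
  move=> n x; apply: (@flat_span_smooth (k *: (('X - a%:P) * (b%:P - 'X)))).
  rewrite (_ : bump _ _ _ = fun x => (1 : {poly R}).[x] *
    flat_expR 1 (k *: (('X - a%:P) * (b%:P - 'X))).[x]).
    exact: flat_span1.
  by apply/funext => y; rewrite /bump hornerC mul1r hornerZ hornerM !hornerE.
exists a, b; split => // x; rewrite in_itv/= => xab.
apply: flat_expR_le0; rewrite mulr_ge0_le0//.
by move: xab; rewrite negb_and -!ltNge => /orP[] h; nra.
Qed.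

Lemma bump_ge0_le1 (a b k x : R) : 0 <= bump a b k x <= 1.
Proof.
rewrite /bump /flat_expR; case: ifPn => [u0|_]; last by rewrite lexx ler01.
by rewrite hornerC mul1r expR_ge0/= -expR0 ler_expR oppr_le0 invr_ge0 ltW.
Qed.

(** The left endpoint b / (n + 2) is positive, so that each bump is compactly
    supported in ]0, 1[, and tends to 0, so that the limit is the indicator of
    the whole of ]0, b[. *)
Lemma cvg_bump_indic (b : R) : 0 < b -> b < 1 -> forall x : R, 0 < x ->
  bump (b / n.+2%:R) b n%:R x @[n --> \oo] --> (\1_(`]0, b[) x : R).
Proof.
move=> b0 b1 x x0.
have [xb|bx] := ltP x b; last first.
  rewrite indicE memNset/=; last by rewrite /= in_itv/= x0 ltNge bx.
  apply: cvg_near_cst; near=> n; apply: flat_expR_le0.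
  rewrite mulr_ge0_le0// mulr_ge0_le0 ?subr_le0// subr_ge0 (le_trans _ bx)//.
  by rewrite ler_pdivrMr ?ltr0n// ler_peMr ?ler1n// ltW.
rewrite indicE mem_set/=; last by rewrite /= in_itv/= x0.
have bx0 : 0 < b - x by rewrite subr_gt0.
pose c := x / 2 * (b - x).
have c0 : 0 < c by rewrite mulr_gt0// divr_gt0.
apply/cvgrPdist_le => e e0; near=> n.
have n0 : 0 < n%:R :> R by rewrite ltr0n; near: n; exact: nbhs_infty_gt.
have an : b / n.+2%:R <= x / 2.
  rewrite ler_pdivrMr ?ltr0n// -ler_pdivrMl ?divr_gt0//.
  rewrite (@le_trans _ _ n%:R) ?ler_nat ?leqW//.
  by near: n; exact: nbhs_infty_ger.
have cu : n%:R * c <= n%:R * ((x - b / n.+2%:R) * (b - x)).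
  by rewrite ler_pM2l// ler_wpM2r//; [exact: ltW|rewrite lerBrDr [leRHS]splitr lerD2l].
have u0 := lt_le_trans (mulr_gt0 n0 c0) cu.
rewrite ger0_norm ?subr_ge0; last by have /andP[] := bump_ge0_le1 (b / n.+2%:R) b n%:R x.
rewrite /bump /flat_expR u0 hornerC mul1r.
have := expR_ge1Dx (- (n%:R * ((x - b / n.+2%:R) * (b - x)))^-1).
suff : (n%:R * ((x - b / n.+2%:R) * (b - x)))^-1 <= e by lra.
apply: (@le_trans _ _ (n%:R * c)^-1); first by rewrite lef_pV2// posrE mulr_gt0.
rewrite -[e]invrK lef_pV2 ?posrE ?invr_gt0 ?mulr_gt0//.
rewrite -ler_pdivrMr//; near: n; exact: nbhs_infty_ger.
Unshelve. all: by end_near. Qed.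

End flat_exponential.

(** * Uniqueness of weak derivatives *)

Section weak_derivatives.
Context {R : realType}.
Local Notation mu := (@lebesgue_measure R).

Lemma continuous_test_function (phi : R -> R) : test_function phi ->
  continuous phi /\ continuous (derive1 phi).
Proof.
move=> [sphi _]; split=> x; apply: differentiable_continuous; apply/derivable1_diffP.
  exact: (sphi 0%N).
exact: (sphi 1%N).
Qed.

(** Both functions are continuous and vanish off a compact interval. *)
Lemma bounded_test_function (phi : R -> R) (D : set R) : test_function phi ->
  [bounded phi x | x in D] /\ [bounded derive1 phi x | x in D].
Proof.
move=> tphi; have [cphi cdphi] := continuous_test_function tphi.
move: tphi => [_ [a [b [a0 b1 supp]]]].
have bnd (f : R -> R) : continuous f -> (forall x, x \notin `[a, b] -> f x = 0) ->
    [bounded f x | x in D].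
  move=> cf f0; have : compact (f @` `[a, b]).
    apply: continuous_compact; last exact: segment_compact.
    exact: continuous_subspaceT.
  move=> /compact_bounded[M [Mreal HM]].
  exists (Num.max 0 M); split; first by rewrite num_real.
  move=> y; rewrite gt_max => /andP[y0 My] x _ /=.
  have [xab|xab] := boolP (x \in `[a, b]); last by rewrite f0// normr0 ltW.
  by apply: HM My _ _; exists x.
split; apply: bnd => // x xab.
rewrite derive1E; apply: derive_val.
have : \forall y \near x, y \notin `[a, b].
  move: xab; rewrite in_itv/= negb_and -!ltNge => /orP[xa|bx].
    near=> y; rewrite in_itv/= negb_and -!ltNge; apply/orP; left; near: y.
    exact: lt_nbhsl.
  near=> y; rewrite in_itv/= negb_and -!ltNge; apply/orP; right; near: y.
  exact: lt_nbhsr.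
move=> yab; apply: (@near_eq_is_derive _ _ _ (cst 0)).
by near=> y; rewrite supp//; near: y.
Unshelve. all: by end_near. Qed.

Lemma integrable_mul_test_function (v phi : R -> R) : test_function phi ->
  mu.-integrable `]0, 1[ (EFin \o v) ->
  mu.-integrable `]0, 1[ (EFin \o (fun x => v x * phi x)) /\
  mu.-integrable `]0, 1[ (EFin \o (fun x => v x * derive1 phi x)).
Proof.
move=> tphi iv; have [cphi cdphi] := continuous_test_function tphi.
have [bphi bdphi] := bounded_test_function (`]0, 1[) tphi.
by split; apply: (@integrableMl _ _ _ mu _ _ (EFin \o v)) => //;
  apply: measurable_funTS; exact: continuous_measurable_fun.
Qed.

(** The primitive of v vanishes on ]0, 1[, and its derivative is v almost
    everywhere by Lebesgue differentiation. *)
Lemma integral_init_eq0 (v : R -> R) : mu.-integrable `]0, 1[ (EFin \o v) ->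
  (forall b, 0 < b -> b < 1 -> \int[mu]_(t in `]0, b[) v t = 0) ->
  \forall t \ae mu, t \in `]0, 1[ -> v t = 0.
Proof.
move=> iv v0; pose f := v \_ `]0, 1[.
have intf : mu.-integrable setT (EFin \o f).
  by rewrite -restrict_EFin; apply/(integrable_mkcond _ _).1.
have intfD (D : set R) : measurable D -> mu.-integrable D (EFin \o f).
  by move=> mD; apply: integrableS intf.
have locf : locally_integrable [set: R] f.
  exact: open_integrable_locally openT intf.
have := @FTC1 R f (BRight 0) (fun y => intfD _ (measurable_itv _)) locf.
apply: filterS; first exact: (ae_filter_ringOfSetsType mu).
move=> x dx /=; rewrite in_itv/= => /andP[x0 x1].
have [_] := dx x0.
rewrite /f patchE mem_set/= ?in_itv/= ?x0// => <-.
rewrite derive1E; apply: derive_val.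
apply: (@near_eq_is_derive _ _ _ (cst 0)).
near=> y.
have y0 : 0 < y by near: y; exact: lt_nbhsr.
have y1 : y < 1 by near: y; exact: lt_nbhsl.
rewrite -Rintegral_itv_bndo_bndc; last by apply: intfD; exact: measurable_itv.
rewrite -[LHS](v0 y y0 y1); apply: eq_Rintegral => t.
rewrite inE/= in_itv/= => /andP[t0 ty].
by rewrite patchE mem_set//= in_itv/= t0 (lt_trans ty).
Unshelve. all: by end_near. Qed.

(** Testing against bumps that converge boundedly to the indicator of ]0, b[
    shows, by dominated convergence, that v has a zero primitive. *)
Lemma fundamental_lemma_variations (v : R -> R) :
  mu.-integrable `]0, 1[ (EFin \o v) ->
  (forall phi, test_function phi -> \int[mu]_(t in `]0, 1[) (v t * phi t) = 0) ->
  \forall t \ae mu, t \in `]0, 1[ -> v t = 0.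
Proof.
move=> iv vphi0; apply: integral_init_eq0 => // b b0 b1.
pose phi n := bump (b / n.+2%:R) b n%:R.
have tphi n : test_function (phi n).
  apply: test_function_bump => //; first by rewrite divr_gt0.
  by rewrite ler_pdivrMr ?ltr0n// ler_peMr ?ler1n// ltW.
have mD : measurable (`]0, 1[ : set R) by exact: measurable_itv.
have mv : measurable_fun (`]0, 1[ : set R) v by apply/measurable_EFinP; exact: measurable_int iv.
have mphi n : measurable_fun (`]0, 1[ : set R) (EFin \o (fun t => v t * phi n t)).
  have [+ _] := integrable_mul_test_function (tphi n) iv.
  by move/measurable_int.
have mlim : measurable_fun (`]0, 1[ : set R) (EFin \o (fun t => v t * \1_(`]0, b[) t)).
  by apply/measurable_EFinP/measurable_funM.
have := @dominated_convergence _ _ R mu _ mD _ _ (abse \o (EFin \o v)) mphi mlim.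
case.
- apply/aeW => t; rewrite /= in_itv/= => /andP[t0 t1].
  by apply: cvg_EFin; [exact: nearW|apply: cvgMr; exact: cvg_bump_indic].
- exact: integrable_abse.
- apply/aeW => t n _; rewrite /= lee_fin normrM ler_piMr//.
  by have /andP[? ?] := bump_ge0_le1 (b / n.+2%:R) b n%:R t; rewrite ger0_norm.
move=> _ _.
rewrite [X in X @ _](_ : _ = cst 0%E); last first.
  apply/funext => n; have [ivphi _] := integrable_mul_test_function (tphi n) iv.
  have := congr1 EFin (vphi0 _ (tphi n)).
  by rewrite /Rintegral fineK//; exact: integrable_fin_num.
move=> /(cvg_unique (@ereal_hausdorff R)) /(_ (@cvg_cst _ _ _ _ _)) intv0.
have -> : (`]0, b[ : set R)%classic = (`]0, 1[ `&` `]0, b[)%classic.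
  apply/seteqP; split=> t /=; rewrite !in_itv/=; last by case.
  by move=> /andP[t0 tb]; rewrite t0 tb (lt_trans tb).
rewrite Rintegral_mkcondr patch_indic.
by rewrite /Rintegral intv0.
Qed.

Lemma weak_derivative_unique (u v w : R -> R) :
  weak_derivative u v -> weak_derivative u w ->
  \forall t \ae mu, t \in `]0, 1[ -> v t = w t.
Proof.
move=> [_ iv Dv] [_ iw Dw].
have mD : measurable (`]0, 1[ : set R) by exact: measurable_itv.
have ivw : mu.-integrable `]0, 1[ (EFin \o (v \- w)).
  by apply: (@integrableB _ _ _ mu _ (measurable_itv _) _ _ iv iw).
have := fundamental_lemma_variations ivw.
have vw0 phi : test_function phi ->
    \int[mu]_(t in `]0, 1[) ((v \- w) t * phi t) = 0.
  move=> tphi; under eq_Rintegral do rewrite /= mulrBl.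
  rewrite RintegralB//.
  - by have := Dv _ tphi; rewrite (Dw _ tphi) => /oppr_inj ->; rewrite subrr.
  - by have [] := integrable_mul_test_function tphi iv.
  - by have [] := integrable_mul_test_function tphi iw.
move=> /(_ vw0); apply: filterS; first exact: (ae_filter_ringOfSetsType mu).
by move=> t vwt t01; apply/eqP; rewrite -subr_eq0; exact/eqP/vwt.
Qed.

Lemma weak_derivativeD (u1 u2 v1 v2 : R -> R) :
  weak_derivative u1 v1 -> weak_derivative u2 v2 ->
  weak_derivative (fun t => u1 t + u2 t) (fun t => v1 t + v2 t).
Proof.
move=> [iu1 iv1 D1] [iu2 iv2 D2].
have mD : measurable (`]0, 1[ : set R) by exact: measurable_itv.
split.
- by apply: (@integrableD _ _ _ mu _ (measurable_itv _) _ _ iu1 iu2).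
- by apply: (@integrableD _ _ _ mu _ (measurable_itv _) _ _ iv1 iv2).
move=> phi tphi.
have [i1 j1] := (integrable_mul_test_function tphi iv1, integrable_mul_test_function tphi iu1).
have [i2 j2] := (integrable_mul_test_function tphi iv2, integrable_mul_test_function tphi iu2).
under eq_Rintegral do rewrite mulrDl.
under [in RHS]eq_Rintegral do rewrite mulrDl.
rewrite RintegralD ?D1 ?D2//; last 2 first.
- exact: j1.2.
- exact: j2.2.
by rewrite RintegralD ?opprD//; [exact: i1.1|exact: i2.1].
Qed.

Lemma weak_derivativeN (u v : R -> R) :
  weak_derivative u v -> weak_derivative (fun t => - u t) (fun t => - v t).
Proof.
move=> [iu iv D1].
have mD : measurable (`]0, 1[ : set R) by exact: measurable_itv.
split.
- by apply: (integrableN iu).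
- by apply: (integrableN iv).
move=> phi tphi.
have [i1 _] := integrable_mul_test_function tphi iv.
have [_ j1] := integrable_mul_test_function tphi iu.
under eq_Rintegral do rewrite mulNr -mulN1r.
under [in RHS]eq_Rintegral do rewrite mulNr -mulN1r.
by rewrite !RintegralZl// D1// !mulN1r.
Qed.

End weak_derivatives.

(** * Null sets of products *)

Section almost_everywhere_implication.
Context d (T : ringOfSetsType d) (R : realFieldType).
Variable mu : {measure set T -> \bar R}.

Lemma ae_imp (A B : T -> Prop) : (forall x, A x -> B x) ->
  (\forall x \ae mu, A x) -> \forall x \ae mu, B x.
Proof.
by move=> AB; apply: filterS => //; exact: ae_filter_ringOfSetsType.
Qed.

Lemma ae_imp2 (A B C : T -> Prop) : (forall x, A x -> B x -> C x) ->
  (\forall x \ae mu, A x) -> (\forall x \ae mu, B x) -> \forall x \ae mu, C x.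
Proof.
by move=> ABC; apply: filterS2 => //; exact: ae_filter_ringOfSetsType.
Qed.

End almost_everywhere_implication.

Section null_sets_product.
Context d1 d2 (T1 : measurableType d1) (T2 : measurableType d2) (R : realType).
Implicit Types (P : {measure set T1 -> \bar R}).
Variable nu : {sigma_finite_measure set T2 -> \bar R}.
Local Open Scope ereal_scope.

Lemma product_measure_eq0P P (N : set (T1 * T2)) : measurable N ->
  (P \x nu) N = 0 <-> \forall x \ae P, nu (xsection N x) = 0.
Proof.
move=> mN; have mF := measurable_fun_xsection nu mN.
have -> : (P \x nu) N = \int[P]_x `|(nu \o xsection N) x|.
  by apply: eq_integral => x _; rewrite gee0_abs.
rewrite (ae_eq_integral_abs P measurableT mF).
by split; apply: filterS => x /= h //; exact: h.
Qed.

Lemma ae_product_dominates P P' (Q : T1 * T2 -> Prop) :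
  (forall A, measurable A -> P A = 0 -> P' A = 0) ->
  (\forall z \ae (P \x nu), Q z) -> \forall z \ae (P' \x nu), Q z.
Proof.
move=> dom [N [mN N0 QN]]; exists N; split => //.
apply/product_measure_eq0P => //.
have /product_measure_eq0P := N0 => /(_ mN).
by move=> [A [mA A0 QA]]; exists A; split => //; exact: dom.
Qed.

Lemma product_measure_ysection0 (P : probability T1 R) (N : set (T1 * T2)) :
  measurable N -> (forall y, P (ysection N y) = 0) -> (P \x nu) N = 0.
Proof.
move=> mN PN.
have := @indic_fubini_tonelli _ _ _ _ _ P nu _ mN.
rewrite indic_fubini_tonelli_FE// indic_fubini_tonelli_GE//.
rewrite -[X in X = _ -> _]/((P \x nu) N) => ->.
by rewrite integral0_eq// => y _ /=; exact: PN.
Qed.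

End null_sets_product.

(** The two endpoints of [0, 1] form a null set. *)
Lemma lebesgue01_null (R : realType) (A : set R) : (measurable : set (set (measurableTypeR R))) A ->
  (\forall t \ae (@lebesgue_measure R), t \in `]0, 1[ -> ~ A t) -> lebesgue01 R A = 0%E.
Proof.
move=> mA [N [mN N0 AN]].
have M0 : lebesgue_measure ([set 0; 1] : set (measurableTypeR R)) = 0%E.
  apply: countable_lebesgue_measure0; apply: finite_set_countable.
  by rewrite finite_setU; split; exact: finite_set1.
rewrite -[LHS]/(lebesgue_measure (A `&` `[0, 1])).
apply: (@subset_measure0 _ _ _ _ _ (N `|` [set 0; 1])) => //.
- by apply: measurableI => //; exact: measurable_itv.
- by apply: measurableU => //; apply: measurableU; exact: measurable_set1.
- move=> t [At]; rewrite /= in_itv/= => /andP[].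
  rewrite le_eqVlt => /predU1P[<- _|t0]; first by right; left.
  rewrite le_eqVlt => /predU1P[-> |t1]; first by right; right.
  by left; apply: AN => /=; rewrite in_itv/= t0 t1 => /(_ isT).
- have m01 : measurable ([set 0; 1] : set (measurableTypeR R)).
    by apply: measurableU; exact: measurable_set1.
  apply: measure_negligible; first exact: measurableU.
  by apply: negligibleU; apply/negligibleP.
Qed.

(** * Evaluation of curves *)

Lemma ex_invS_lt (R : realType) (e : R) : 0 < e -> exists k : nat, k.+1%:R^-1 < e.
Proof.
move=> e0; have [N _ HN] := near_infty_natSinv_lt (PosNum e0).
by exists N; exact: (HN N (leqnn N)).
Qed.

Lemma ex_rat_near (R : realType) (t e : R) : 0 < e -> exists s : rat, `|t - ratr s| < e.
Proof.
move=> e0; have : t < t + e by rewrite ltrDl.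
move=> /rat_in_itvoo[s]; rewrite in_itv/= => /andP[ts se].
by exists s; rewrite ltr0_norm ?subr_lt0// opprB ltrBlDl.
Qed.

Lemma measurable_open_borel (T : ptopologicalType) (U : set T) : open U ->
  (measurable : set (set (borel T))) U.
Proof. by move=> oU; exact: sub_sigma_algebra. Qed.

Lemma open_metric_ball (R : realType) (X : metricType R) (x : X) (r : R) : open (ball x r).
Proof.
rewrite openE => y; rewrite ballEmdist/= => xy.
apply/metricType_numDomainType.nbhs_mdistP; exists (r - mdist x y).
  by rewrite /= subr_gt0.
move=> z /= yz; rewrite (le_lt_trans (metric_triangle _ y _))//.
by rewrite -ltrBrDl.
Qed.

Section curves_and_time.
Context {R : realType} {X : completeMetricType R}.
Local Notation CT := (borel (curve R X) * measurableTypeR R)%type.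

Lemma clamp01_id (t : R) : 0 <= t <= 1 -> clamp01 t = t.
Proof. by move=> /andP[t0 t1]; rewrite /clamp01 min_r// max_r. Qed.

Lemma evalc_clamp01 t (g : curve R X) : evalc (clamp01 t) g = evalc t g.
Proof.
rewrite /evalc; congr (_ _); apply: val_inj => /=.
by rewrite clamp01_id//; have := set_mem (clamp01_in t); rewrite /unit_interval/= in_itv.
Qed.

Lemma continuous_clamp01 : continuous (@clamp01 R).
Proof.
have -> : @clamp01 R = (cst 0 \max (cst 1 \min id)) by [].
move=> x; apply: continuous_max; first exact: cst_continuous.
by apply: continuous_min; [exact: cst_continuous|move=> y; exact: cvg_id].
Qed.

Lemma continuous_unit_pt : continuous (@unit_pt R).
Proof.
apply: (@continuous_comp_initial _ _ _ (set_val : unit_interval R -> R)).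
exact: continuous_clamp01.
Qed.

Lemma continuous_evalc_time (g : curve R X) : continuous (fun t => evalc t g).
Proof.
move=> t; apply: (continuous_comp (f := @unit_pt R)); first exact: continuous_unit_pt.
exact: (@cts_fun _ _ g).
Qed.

Lemma mdist_evalc_le t (g h : curve R X) : mdist (evalc t g) (evalc t h) <= mdist g h.
Proof. exact: mdist_le_dsup. Qed.

Lemma continuous_evalc t : continuous (evalc t : curve R X -> X).
Proof.
move=> g; have FF : Filter (nbhs g) := nbhs_filter g.
apply/(@metricType_numDomainType.cvgrPdist_lt _ _ _ (nbhs g) FF) => e e0.
apply/metricType_numDomainType.nbhs_mdistP; exists e => //= h.
exact/le_lt_trans/mdist_evalc_le.
Qed.

Lemma measurable_evalc t :
  measurable_fun setT (evalc t : borel (curve R X) -> borel X).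
Proof.
apply: (@measurability _ _ (borel (curve R X)) (borel X) setT _ (@open X)) => //.
move=> _ [U oU <-].
rewrite setTI; apply: measurable_open_borel.
by apply: open_comp => // g _; exact: continuous_evalc.
Qed.

Lemma evalc_time_near (g : curve R X) (t e : R) : 0 < e ->
  exists2 d, 0 < d & forall s, `|t - s| < d -> mdist (evalc t g) (evalc s g) < e.
Proof.
move=> e0; have := @continuous_evalc_time g t.
have FF : Filter (nbhs t) := nbhs_filter t.
move=> /(@metricType_numDomainType.cvgrPdist_lt _ _ _ _ FF) /(_ e e0) [d d0 td].
by exists d.
Qed.

(** Evaluation is measurable in the curve and continuous in time.  A value g_t
    lies in an open set U as soon as rational times s arbitrarily close to t
    give values g_s at a distance bounded below from the complement of U; this
    describes the preimage of U by countably many measurable rectangles. *)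
Lemma measurable_evalc_joint :
  measurable_fun setT (fun gt : CT => evalc gt.2 gt.1 : borel X).
Proof.
apply: (@measurability _ _ CT (borel X) setT _ (@open X)) => //.
move=> _ [U oU <-]; rewrite setTI.
(* the points at distance at least 1 / (k + 1) from the complement of U *)
pose V k := [set x : X | forall y, ~ U y -> k.+1%:R^-1 <= mdist x y :> R].
have mV k : (measurable : set (set (borel X))) (V k).
  rewrite -[V k]setCK; apply: measurableC; apply: measurable_open_borel.
  rewrite (_ : ~` _ = \bigcup_(y in ~` U) ball y (k.+1%:R^-1 : R)).
    by apply: bigcup_open => y _; exact: open_metric_ball.
  apply/seteqP; split=> x /=.
    move=> /existsNP[y /not_implyP[Uy]] /negP; rewrite -ltNge => xy; exists y => //.
    by rewrite ballEmdist/= metric_sym.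
  move=> [y Uy]; rewrite ballEmdist/= metric_sym => xy /(_ y Uy).
  by rewrite leNgt xy.
rewrite (_ : _ @^-1` U = \bigcup_k \bigcap_j \bigcup_(s : rat)
    ((evalc (ratr s) @^-1` V k : set (borel (curve R X))) `*`
     (ball (ratr s : R) (j.+1%:R^-1 : R) : set (measurableTypeR R)))).
  apply: bigcupT_measurable => k; apply: bigcapT_measurable => j.
  apply: bigcupT_measurable_rat => s; apply: measurableX.
    by rewrite -[X in measurable X]setTI; exact: measurable_evalc.
  exact: measurable_ball.
apply/seteqP; split=> [[g t] /= Ut|[g t] /= [k _ gtk]].
  have : nbhs (evalc t g) U by exact: open_nbhs_nbhs.
  move=> /metricType_numDomainType.nbhs_mdistP[e /= e0 eU].
  have [k ke] := ex_invS_lt (divr_gt0 e0 (ltr0Sn _ 1)).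
  exists k => // j _.
  have [d /= d0 td] := evalc_time_near g t (divr_gt0 e0 (ltr0Sn _ 1)).
  have [s [sj sd]] : exists s : rat, `|t - ratr s| < j.+1%:R^-1 /\ `|t - ratr s| < d.
    have : 0 < Num.min (j.+1%:R^-1) d by rewrite lt_min invr_gt0 ltr0Sn.
    by move=> /(ex_rat_near t)[s]; rewrite lt_min => /andP[]; exists s.
  exists s => //; split => /=; last by rewrite /ball/= distrC.
  move=> y Uy; have := td (ratr s) sd => h.
  rewrite leNgt; apply/negP => sy; apply: Uy; apply: eU => /=.
  rewrite (le_lt_trans (metric_triangle _ (evalc (ratr s) g) _))//.
  rewrite [ltRHS]splitr ltrD// (lt_trans sy)//.
apply: contrapT => Ut.
have kV0 : 0 < k.+1%:R^-1 :> R by rewrite invr_gt0 ltr0n.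
have [d /= d0 td] := evalc_time_near g t kV0.
have [j jd] := ex_invS_lt d0.
have [s _ [/= Vs sj]] := gtk j I.
have := td (ratr s); rewrite distrC (lt_trans sj jd) => /(_ isT).
by rewrite metric_sym ltNge Vs.
Qed.

(** Fubini: equality for almost every time along almost every curve. *)
Lemma ae_eq_along (P : probability (borel (curve R X)) R)
    (f1 f2 : borel (curve R X) * R -> R) :
  measurable_fun setT f1 -> measurable_fun setT f2 ->
  (\forall g \ae P, \forall t \ae (@lebesgue_measure R),
     t \in `]0, 1[ -> f1 (g, t) = f2 (g, t)) ->
  \forall gt \ae (P \x lebesgue01 R)%E, f1 gt = f2 gt.
Proof.
move=> mf1 mf2 f12; exists [set gt | f1 gt != f2 gt].
have mN : measurable ([set gt | f1 gt != f2 gt] : set CT).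
  have := measurable_fun_eqr mf1 mf2 => /(_ measurableT [set false]).
  rewrite setTI (_ : _ @^-1` _ = [set gt | f1 gt != f2 gt]); first exact.
  by apply/seteqP; split=> z /=; [move=> ->|move=> /negbTE].
split => //; last by move=> z /= /eqP.
apply/product_measure_eq0P => //; apply: filterS f12 => g f12.
apply: lebesgue01_null; first exact: measurable_xsection.
move: f12; apply: filterS; first exact: (ae_filter_ringOfSetsType lebesgue_measure).
move=> t f12 t01; rewrite /xsection/= inE/=.
by rewrite f12// eqxx.
Qed.

(** An m-null set is met by almost no curve at any given time, because the
    time marginals of P are controlled by m; Fubini exchanges the order of the
    quantifiers. *)
Lemma ae_along_of_ae (m : {measure set (borel X) -> \bar R})
    (P : probability (borel (curve R X)) R) (C : R) (Q : X -> Prop) :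
  (forall t, t \in unit_interval R -> forall A : set (borel X), measurable A ->
     (pushforward P (evalc t : borel (curve R X) -> borel X) A <= C%:E * m A)%E) ->
  (\forall x \ae m, Q x) ->
  \forall gt \ae (P \x lebesgue01 R)%E, Q (evalc gt.2 gt.1).
Proof.
move=> PC [N [mN N0 QN]].
exists ((fun gt : CT => evalc gt.2 gt.1 : borel X) @^-1` N).
have mN' : measurable ((fun gt : CT => evalc gt.2 gt.1 : borel X) @^-1` N).
  by rewrite -[X in measurable X]setTI; exact: measurable_evalc_joint.
split => //; last by move=> z /= Qz; apply: QN.
apply: product_measure_ysection0 => // t.
apply/eqP; rewrite eq_le measure_ge0 andbT.
have := PC _ (clamp01_in t) _ mN; rewrite N0 mule0; apply: le_trans.
rewrite /pushforward; apply: le_measure; rewrite ?inE.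
- exact: measurable_ysection.
- by rewrite -[X in measurable X]setTI; exact: measurable_evalc.
- by move=> g; rewrite /ysection/= inE/= evalc_clamp01.
Qed.

End curves_and_time.

(** * Energies and their extrema *)

Section attained_supremum.
Context {R : realType} {T : Type}.

(** Apply the countable upper bound property to a maximizing sequence. *)
Lemma countably_directed_max (J : T -> R) (M : R) (t0 : T) :
  (forall t, J t <= M) ->
  (forall s : nat -> T, exists t, forall n, J (s n) <= J t) ->
  exists t, forall t', J t' <= J t.
Proof.
move=> JM dir; pose E := [set J t | t in [set: T]].
have supE : has_sup E.
  by split; [exists (J t0), t0|exists M => _ [t _ <-]].
have near_sup n : exists t, sup E - n.+1%:R^-1 < J t.
  have n0 : 0 < n.+1%:R^-1 :> R by rewrite invr_gt0 ltr0n.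
  by have [_ [t _ <-] ht] := sup_adherent n0 supE; exists t.
have [s hs] := choice near_sup; have [t ht] := dir s.
exists t => t'; apply: (@le_trans _ _ (sup E)).
  by apply: ub_le_sup; [exact: supE.2|exists t'].
rewrite leNgt; apply/negP => ltJ.
have gap : 0 < sup E - J t by rewrite subr_gt0.
have [k kd] := ex_invS_lt gap.
have := lt_le_trans (hs k) (ht k).
by rewrite ltrBlDr -ltrBlDl => /(lt_trans kd); rewrite ltxx.
Qed.

End attained_supremum.

Section Lp_energy.
Context d {T : measurableType d} {R : realType}.
Variables (mu : {measure set T -> \bar R}) (p : R).
Hypothesis p1 : 1 <= p.
Implicit Types f g h : T -> R.

Definition Lp_energy f : R := \int[mu]_x (`|f x| `^ p).

Lemma Lfun_measurable f : f \in Lfun mu p%:E -> measurable_fun setT f.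
Proof. by rewrite inE => /andP[+ _]; rewrite inE. Qed.

Let p_ge0 : 0 <= p. Proof. exact: le_trans p1. Qed.

Let measurable_powR_norm f : measurable_fun setT f ->
  measurable_fun setT (fun x => (`|f x| `^ p)%:E).
Proof.
move=> mf; apply/measurable_EFinP.
by apply: (measurableT_comp (measurable_powR _)) => //; exact: measurableT_comp.
Qed.

Lemma Lfun_ae_dominated h g : measurable_fun setT h -> g \in Lfun mu p%:E ->
  (\forall x \ae mu, `|h x| <= `|g x|) -> h \in Lfun mu p%:E.
Proof.
move=> mh Lg hg; have /integrableP[_] := Lfun_integrable p1 Lg.
rewrite inE => fing; apply/andP; split; rewrite inE//=.
rewrite /finite_norm unlock; apply: poweR_lty; apply: le_lt_trans fing.
apply: ae_ge0_le_integral => //.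
- by move=> x _; exact: poweR_ge0.
- exact: measurable_powR_norm.
- by apply: measurableT_comp => //; apply: measurable_powR_norm; exact: Lfun_measurable.
- apply: filterS hg => x hg _.
  by rewrite [leRHS]/= (ger0_norm (powR_ge0 _ _)) lee_fin ge0_ler_powR// ?nnegrE.
Qed.

Lemma le_Lp_energy h g : h \in Lfun mu p%:E -> g \in Lfun mu p%:E ->
  (\forall x \ae mu, `|h x| <= `|g x|) -> Lp_energy h <= Lp_energy g.
Proof.
move=> Lh Lg hg; apply: fine_le.
- exact: integrable_fin_num (Lfun_integrable p1 Lh).
- exact: integrable_fin_num (Lfun_integrable p1 Lg).
apply: ae_ge0_le_integral => //.
- by apply: measurable_powR_norm; exact: Lfun_measurable.
- by apply: measurable_powR_norm; exact: Lfun_measurable.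
- by apply: filterS hg => x hg _; rewrite lee_fin ge0_ler_powR// ?nnegrE.
Qed.

(** The difference of the p-th powers is nonnegative with zero integral. *)
Lemma Lp_energy_rigidity h g : h \in Lfun mu p%:E -> g \in Lfun mu p%:E ->
  (\forall x \ae mu, 0 <= h x <= g x) -> Lp_energy g <= Lp_energy h ->
  \forall x \ae mu, h x = g x.
Proof.
move=> Lh Lg hg gh.
have [ih ig] := (Lfun_integrable p1 Lh, Lfun_integrable p1 Lg).
have iD := integrableB measurableT ig ih.
pose D x := ((`|g x| `^ p)%:E - (`|h x| `^ p)%:E)%E.
have D0 : \forall x \ae mu, (0 <= D x)%E.
  apply: filterS hg => x /andP[h0 hg]; rewrite sube_ge0 ?lee_fin//.
  by rewrite !ger0_norm ?(le_trans h0)// ge0_ler_powR// ?nnegrE// (le_trans h0).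
have : (\int[mu]_x `|D x| = 0)%E.
  have mD := measurable_int mu iD.
  apply/eqP; rewrite eq_le integral_ge0// andbT.
  rewrite (@ae_eq_integral _ _ _ mu setT D) => //; last 2 first.
  - exact: measurableT_comp.
  - by apply: filterS D0 => x D0 _; rewrite gee0_abs.
  rewrite integralB// sube_le0.
  rewrite -(fineK (integrable_fin_num measurableT ig)).
  by rewrite -(fineK (integrable_fin_num measurableT ih)) lee_fin.
move=> /(ae_eq_integral_abs mu measurableT (measurable_int mu iD)) hD.
apply: filterS2 hg hD => x /andP[h0 hg] /(_ I)/eqP.
have g0 := le_trans h0 hg; rewrite sube_eq ?fin_numE//= add0e => /eqP[].
by rewrite !ger0_norm// => /powR_injective -> //; rewrite (lt_le_trans _ p1).
Qed.

Lemma Lp_energyZ (c : R) g : 0 <= c -> g \in Lfun mu p%:E ->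
  Lp_energy (fun x => c * g x) = c `^ p * Lp_energy g.
Proof.
move=> c0 Lg; rewrite /Lp_energy -RintegralZl//; last exact: Lfun_integrable.
by apply: eq_Rintegral => x _; rewrite normrM (ger0_norm c0) powRM.
Qed.

Lemma poweR_root_lt (a b : \bar R) (e : R) : 0 < e -> (0 <= a)%E -> (0 <= b)%E ->
  ((a + b) `^ p^-1 < e%:E)%E -> (b <= (e `^ p)%:E)%E.
Proof.
move=> e0 a0 b0 /ltW root_le.
have p0 : 0 < p by exact: lt_le_trans p1.
apply: (@le_trans _ _ (a + b)%E); first exact: leeDr.
have -> : (a + b = (a + b) `^ p^-1 `^ p)%E.
  by rewrite -poweRrM mulVf ?gt_eqF// poweRe1// adde_ge0.
rewrite -poweR_EFin; apply: gt0_ler_poweR root_le.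
- exact: ltW.
- by rewrite in_itv/= poweR_ge0 leey.
- by rewrite in_itv/= lee_fin (ltW e0) leey.
Qed.

End Lp_energy.

(** * Weak upper gradients *)

Section weak_upper_gradients.
Context {R : realType} {X : completeMetricType R}.
Variables (m : {measure set (borel X) -> \bar R}) (p q : R).
Hypothesis p1 : 1 < p.
Implicit Types (Pi : set (plan X)) (f G : X -> R) (P : plan X).

Local Notation wug := (weak_upper_gradient m).
Local Notation Lp := (@Lfun _ (borel X) R m p%:E).

Let p_ge1 : 1 <= p. Proof. exact: ltW. Qed.

(** When the difference quotients do not converge, the speed is the default
    value of [lim], which is 0. *)
Lemma metric_speed_ge0 (g : curve R X) (t : R) : 0 <= metric_speed g t.
Proof.
rewrite /metric_speed; have [cv|ncv] := pselect (cvg (diff_quotient g t @ 0^')).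
  apply: limr_ge => //; apply: nearW => h.
  by rewrite /diff_quotient divr_ge0// mdist_ge0.
by rewrite (dvgP ncv).
Qed.

Lemma wug_mono Pi Pi' f G : Pi `<=` Pi' -> wug Pi' p f G -> wug Pi p f G.
Proof. by move=> PiPi' [LG G0 HG]; split=> // P /PiPi'; exact: HG. Qed.

(** All the conditions along a plan are almost everywhere conditions. *)
Lemma wug_dominated P P' f G :
  (forall A, measurable A -> P A = 0%E -> P' A = 0%E) ->
  wug [set P] p f G -> wug [set P'] p f G.
Proof.
move=> dom [LG G0 HG]; split=> // _ ->.
have [Sf [df [mdf wdf] bound]] := HG P erefl.
have ae_dom (Q : borel (curve R X) -> Prop) :
    (\forall g \ae P, Q g) -> \forall g \ae P', Q g.
  by move=> [N [mN N0 QN]]; exists N; split=> //; exact: dom.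
split; first exact: ae_dom.
exists df; first by split => //; exact: ae_dom.
exact: ae_product_dominates bound.
Qed.

(** The curves of a test plan do not see the m-null set where G and G' differ:
    almost every curve avoids it at almost every time. *)
Lemma wug_ae_eq Pi f G G' : Pi `<=` test_plans m q ->
  wug Pi p f G -> measurable_fun setT (G' : borel X -> R) ->
  (\forall x \ae m, G x = G' x) -> wug Pi p f G'.
Proof.
move=> Pitp [LG G0 HG] mG' GG'; split.
- apply: Lfun_ae_dominated LG _ => //.
  by move: GG'; apply: ae_imp => x ->.
- by move: G0 GG'; apply: ae_imp2 => x + <-.
- move=> P PiP; have [Sf [df [mdf wdf] bound]] := HG P PiP.
  split => //; exists df => //.
  have [_ [C C0 PC] _] := Pitp P PiP.
  have := ae_along_of_ae PC GG'.
  by move: bound; apply: ae_imp2 => gt bound <-.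
Qed.

Lemma wugB Pi f1 f2 G1 G2 : wug Pi p f1 G1 -> wug Pi p f2 G2 ->
  wug Pi p (fun x => f1 x - f2 x) (fun x => G1 x + G2 x).
Proof.
move=> [LG1 G10 HG1] [LG2 G20 HG2]; split.
- have p1E : (1 <= p%:E)%E by rewrite lee_fin.
  exact: (Lfun_addr_closed m p1E).2.
- by move: G10 G20; apply: ae_imp2 => x ? ?; exact: addr_ge0.
- move=> P PiP; have [_ [df1 [mdf1 wdf1] bound1]] := HG1 P PiP.
  have [_ [df2 [mdf2 wdf2] bound2]] := HG2 P PiP.
  have wdf : \forall g \ae P, weak_derivative
      (fun t => f1 (evalc t g) - f2 (evalc t g)) (fun t => df1 (g, t) - df2 (g, t)).
    move: wdf1 wdf2; apply: ae_imp2 => g w1 w2.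
    exact: weak_derivativeD w1 (weak_derivativeN w2).
  split; first by move: wdf; apply: ae_imp => g w; exists (fun t => df1 (g, t) - df2 (g, t)).
  exists (fun gt => df1 gt - df2 gt); first by split => //; exact: measurable_funB.
  move: bound1 bound2; apply: ae_imp2 => gt b1 b2.
  by rewrite mulrDl (le_trans (ler_normB _ _))// lerD.
Qed.

Lemma wugN Pi f G : wug Pi p f G -> wug Pi p (fun x => - f x) G.
Proof.
move=> [LG G0 HG]; split=> // P /HG[Sf [df [mdf wdf] bound]]; split.
  by move: Sf; apply: ae_imp => g [v wv]; exists (fun t => - v t); exact: weak_derivativeN.
exists (fun gt => - df gt); first split; first exact: measurable_funN.
  by move: wdf; apply: ae_imp => g; exact: weak_derivativeN.
by move: bound; apply: ae_imp => gt; rewrite normrN.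
Qed.

Lemma inf_norm_ge0 (Gs : nat -> X -> R) x : 0 <= inf (range (fun n => `|Gs n x|)).
Proof.
by apply: lb_le_inf; [exists `|Gs 0%N x|, 0%N|move=> _ [n _ <-]].
Qed.

Lemma inf_norm_le (Gs : nat -> X -> R) n x :
  inf (range (fun n => `|Gs n x|)) <= `|Gs n x|.
Proof. by apply: ge_inf; [exists 0 => _ [k _ <-]|exists n]. Qed.

(** Uniqueness of weak derivatives allows to use the same function df in the
    bounds given by all the Gs n, so that the infimum is a bound too.  The
    absolute values provide a lower bound at every point, the Gs n being
    nonnegative only almost everywhere. *)
Lemma wug_inf Pi f (Gs : nat -> X -> R) : (forall n, wug Pi p f (Gs n)) ->
  wug Pi p f (fun x => inf (range (fun n => `|Gs n x|))).
Proof.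
move=> wG; set I := (X in wug _ _ _ X).
have lb x : has_lbound (range (fun n => `|Gs n x|)) by exists 0 => _ [n _ <-].
have I0 x : 0 <= I x := inf_norm_ge0 Gs x.
have IG n x : I x <= `|Gs n x| := inf_norm_le Gs n x.
have mGs n : measurable_fun setT (Gs n : borel X -> R).
  by have [/Lfun_measurable] := wG n.
have mI : measurable_fun setT (I : borel X -> R).
  have -> : I = fun x => infs ((fun n x => `|Gs n x|) ^~ x) 0%N.
    apply/funext => x; rewrite /infs/= /I; congr inf.
    by apply/seteqP; split=> y [n]; [move=> _ <-; exists n|move=> _ <-; exists n].
  apply: measurable_fun_infs => [x _|n]; first exact: lb.
  exact: measurableT_comp.
split.
- have [LG _ _] := wG 0%N; apply: Lfun_ae_dominated LG _ => //.
  by apply: aeW => x; rewrite (ger0_norm (I0 x)).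
- exact: aeW.
- move=> P PiP; have [_ _ /(_ P PiP)[Sf [df [mdf wdf] _]]] := wG 0%N.
  split => //; exists df => //.
  have allG : \forall gt \ae (P \x lebesgue01 R)%E, forall n,
      `|df gt| <= `|Gs n (evalc gt.2 gt.1)| * metric_speed gt.1 gt.2.
    apply: ae_foralln => n.
    have [_ _ /(_ P PiP)[_ [dfn [mdfn wdfn] bn]]] := wG n.
    have dfE := ae_eq_along mdf mdfn.
    have : \forall gt \ae (P \x lebesgue01 R)%E, df gt = dfn gt.
      by apply: dfE; move: wdf wdfn; apply: ae_imp2 => g; exact: weak_derivative_unique.
    move: bn; apply: ae_imp2 => gt bn ->; apply: (le_trans bn).
    by rewrite ler_wpM2r ?metric_speed_ge0// ler_norm.
  move: allG; apply: ae_imp => gt allG.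
  have := metric_speed_ge0 gt.1 gt.2; rewrite le_eqVlt => /predU1P[s0|s0].
    by have := allG 0%N; rewrite -s0 !mulr0.
  rewrite -ler_pdivrMr//; apply: lb_le_inf.
    by exists `|Gs 0%N (evalc gt.2 gt.1)|, 0%N.
  by move=> _ [n _ <-]; rewrite ler_pdivrMr.
Qed.

(** A weak upper gradient Gm of least energy is minimal: its infimum with any
    other one has no smaller energy, so it equals Gm almost everywhere.  Then
    Gm is an essential infimum, and so agrees with the chosen representative
    up to an m-null set. *)
Lemma min_wugP Pi f : Pi `<=` test_plans m q -> (exists G, wug Pi p f G) ->
  wug Pi p f (min_weak_upper_gradient m Pi p f) /\
  forall h, wug Pi p f h -> \forall x \ae m, min_weak_upper_gradient m Pi p f x <= h x.
Proof.
move=> Pitp [G0 wG0].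
pose T := {G | wug Pi p f G}.
pose J (t : T) : R := - Lp_energy m p (sval t).
have J0 t : J t <= 0.
  by rewrite oppr_le0; apply: Rintegral_ge0 => x _; exact: powR_ge0.
have dir (s : nat -> T) : exists t, forall n, J (s n) <= J t.
  have wI := wug_inf (fun n => svalP (s n)).
  exists (exist _ _ wI) => n; rewrite /J/= lerN2.
  have [LI _ _] := wI; have [Ls _ _] := svalP (s n).
  apply: le_Lp_energy => //; apply: aeW => x.
  rewrite (ger0_norm (inf_norm_ge0 (fun n => sval (s n)) x)).
  exact: (inf_norm_le (fun n => sval (s n))).

have [[Gm wGm] maxJ] := countably_directed_max (exist _ _ wG0) J0 dir.
(* the infimum of Gm and h, as the infimum of the sequence Gm, h, h, ... *)
have Gm_le h : wug Pi p f h -> \forall x \ae m, Gm x <= h x.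
  move=> wh; pose s n := if n is 0%N then Gm else h.
  have ws n : wug Pi p f (s n) by case: n.
  have wI := wug_inf ws.
  have [LI _ _] := wI; have [LGm Gm0 _] := wGm; have [_ h0 _] := wh.
  have := maxJ (exist _ _ wI); rewrite /J/= lerN2 => energy.
  have : \forall x \ae m, inf (range (fun n => `|s n x|)) = Gm x.
    apply: Lp_energy_rigidity energy => //.
    move: Gm0; apply: ae_imp => x Gmx0.
    by rewrite inf_norm_ge0/= (le_trans (inf_norm_le _ 0%N _))//= ger0_norm.
  move: h0; apply: ae_imp2 => x hx0 <-.
  by rewrite (le_trans (inf_norm_le _ 1%N _))//= ger0_norm.
have [LGm _ _] := wGm.
have infGm : ess_infimum m (wug Pi p f) Gm.
  by split => [||h _]; [exact: Lfun_measurable LGm|exact: Gm_le|exact].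
rewrite /min_weak_upper_gradient; set mw := xget _ _.
have [mmw mwlb mwglb] : ess_infimum m (wug Pi p f) mw.
  exact: (xgetPex (cst 0) (ex_intro _ _ infGm)).
split=> //; apply: (wug_ae_eq Pitp wGm) => //.
have := mwglb _ (Lfun_measurable LGm) Gm_le.
have := mwlb _ wGm.
by apply: ae_imp2 => x le1 le2; apply/eqP; rewrite eq_le le1 le2.
Qed.

End weak_upper_gradients.

(** * Mixtures of test plans *)

Section mixtures.
Import HBNNSimple.
Context d {T : measurableType d} {R : realType}.
Implicit Types (P Q : {measure set T -> \bar R}).
Local Open Scope ereal_scope.

(** For an arbitrary nonnegative F the integral is the lower integral, a
    supremum over simple functions, and the integral of each of these is
    additive in the measure.  This is the form in which the energy of curves
    is used. *)
Lemma ge0_integral_le_mixture P (Q : nat -> {measure set T -> \bar R})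
    (a : nat -> {nonneg R}) (F : T -> \bar R) :
  (forall x, 0 <= F x) ->
  (forall A, measurable A -> P A = \sum_(n <oo) (a n)%:num%:E * Q n A) ->
  \int[P]_x F x <= \sum_(n <oo) (a n)%:num%:E * \int[Q n]_x F x.
Proof.
move=> F0 PE; rewrite ge0_integralTE//; apply: ge_ereal_sup => _ [h hF <-].
rewrite -integralT_nnsfun.
rewrite (eq_measure_integral (mseries (fun n => mscale (a n) (Q n)) 0)); last first.
  by move=> A mA _; exact: PE.
rewrite ge0_integral_measure_series//; last 2 first.
- by move=> x _; rewrite lee_fin.
- by apply/measurable_EFinP; exact: measurable_funP.
have h0 x : 0 <= (h x)%:E by rewrite lee_fin.
apply: lee_nneseries => n _; first by move=> _; exact: integral_ge0.
rewrite ge0_integral_mscale//; last by apply/measurable_EFinP; exact: measurable_funP.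
rewrite lee_wpmul2l// integralT_nnsfun ge0_integralTE//.
by apply: ereal_sup_ubound; exists h.
Qed.

Lemma mnormalizeE P (P0 : probability T R) (c : \bar R) A :
  P setT = c -> 0 < c < +oo -> mnormalize P P0 A = ((fine c)^-1)%:E * P A.
Proof.
by move=> <- /andP[c0 cy]; rewrite /mnormalize gt_eqF//= lt_eqF//= muleC.
Qed.

(** The weights decrease fast enough to make the constants c n summable against
    them; K accounts for the normalization. *)
Lemma ex_mixture (Q : nat -> probability T R) (c : nat -> R) :
  (forall n, (0 <= c n)%R) ->
  exists (P : probability T R) (a : nat -> {nonneg R}) (K : R),
  [/\ (0 < K)%R,
      forall n, (0 < (a n)%:num)%R,
      forall A, measurable A -> P A = \sum_(n <oo) (a n)%:num%:E * Q n A &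
      forall n, ((a n)%:num * c n <= K / (2 ^ n.+1)%:R)%R].
Proof.
move=> c0.
pose w n : R := ((2 ^ n.+1)%:R^-1 / (1 + c n))%R.
have w0 n : (0 < w n)%R.
  by rewrite divr_gt0 ?invr_gt0 ?ltr0n ?expn_gt0//; have := c0 n; lra.
have wle n : (w n <= (2 ^ n.+1)%:R^-1)%R.
  rewrite ler_pdivrMr ?ler_peMr ?invr_ge0 ?lerDl//; have := c0 n; lra.
pose wn n : {nonneg R} := NngNum (ltW (w0 n)).
pose mu := mseries (fun n => mscale (wn n) (Q n)) 0.
have muE A : mu A = \sum_(n <oo) (w n)%:E * Q n A by [].
have muT_lty : mu setT <= 1.
  rewrite muE; apply: (le_trans _ (@epsilon_trick0 R 1 xpredT ler01)).
  apply: lee_nneseries => n _; first by move=> _; rewrite mule_ge0// lee_fin ltW.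
  by rewrite [X in _ * X]probability_setT mule1 lee_fin div1r.
have muT_gt0 : 0 < mu setT.
  apply: (@lt_le_trans _ _ ((w 0%N)%:E * Q 0%N setT)).
    by rewrite [X in _ * X]probability_setT mule1 lte_fin.
  rewrite muE (@nneseriesD1 _ _ 0%N xpredT)//.
    rewrite leeDl//; apply: nneseries_ge0 => n _ _.
    by rewrite mule_ge0// lee_fin ltW.
  by move=> n _; rewrite mule_ge0// lee_fin ltW.
have muT_fin : mu setT \is a fin_num.
  by rewrite ge0_fin_numE ?ltW// (le_lt_trans muT_lty) ?ltry.
pose k := (fine (mu setT))^-1%R.
have k0 : (0 < k)%R by rewrite invr_gt0 fine_gt0// muT_gt0 (le_lt_trans muT_lty) ?ltry.
have a0 n : (0 <= k * w n)%R by rewrite mulr_ge0// ltW.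
exists (mnormalize mu (Q 0%N)), (fun n => NngNum (a0 n)), k; split => //.
- by move=> n /=; rewrite mulr_gt0.
- move=> A mA; transitivity (k%:E * mu A).
    apply: mnormalizeE => //; by rewrite muT_gt0 (le_lt_trans muT_lty) ?ltry.
  rewrite muE -nneseriesZl//; last first.
    by move=> n _; rewrite mule_ge0// lee_fin ltW.
  by apply: eq_eseriesr => n _; rewrite EFinM muleA.
- move=> n /=; rewrite -mulrA ler_pM2l//.
  rewrite /w -mulrA ler_piMr ?invr_ge0// mulrC ler_pdivrMr ?mul1r ?lerDr//.
  by have := c0 n; lra.
Qed.

End mixtures.

Section mixture_of_test_plans.
Context {R : realType} {X : completeMetricType R}.
Variables (m : {measure set (borel X) -> \bar R}) (q : R).
Local Open Scope ereal_scope.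

(** The weights are taken small against both the compression constants and the
    energies of the plans, which bounds those of the mixture. *)
Lemma mixture_test_plan (Q : nat -> plan X) : (forall n, test_plan m q (Q n)) ->
  exists2 P : plan X, test_plan m q P &
    forall n A, measurable A -> P A = 0 -> Q n A = 0.
Proof.
move=> Qtp.
pose F (g : borel (curve R X)) := \int[lebesgue_measure]_(t in unit_interval R)
   (metric_speed g t `^ q)%:E.
have F0 g : 0 <= F g by apply: integral_ge0 => t _; rewrite lee_fin powR_ge0.
have Cex n : exists C : R, (0 < C)%R /\ forall t, t \in unit_interval R ->
    forall A : set (borel X), measurable A ->
    pushforward (Q n) (evalc t : borel (curve R X) -> borel X) A <= C%:E * m A.
  by have [_ [C C0 HC] _] := Qtp n; exists C.
have [C HC] := choice Cex.
pose e n := fine (\int[Q n]_g F g).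
have eE n : \int[Q n]_g F g = (e n)%:E.
  have [_ _ Flty] := Qtp n.
  by rewrite fineK// ge0_fin_numE//; exact: integral_ge0.
have e0 n : (0 <= e n)%R by rewrite fine_ge0// integral_ge0.
have c0 n : (0 <= C n + e n)%R by rewrite addr_ge0// ltW// (HC n).1.
have [P [a [K [K0 apos PE aK]]]] := ex_mixture Q c0.
have K2 n : (0 <= K / (2 ^ n.+1)%:R)%R by rewrite divr_ge0// ltW.
have PE0 A : measurable A -> (forall n, Q n A = 0) -> P A = 0.
  move=> mA QA; rewrite PE// eseries0// => n _ _.
  by rewrite QA mule0.
exists P; last first.
  move=> n A mA; rewrite PE// (@nneseriesD1 _ _ n xpredT)//; last first.
    by move=> k _; rewrite mule_ge0.
  move=> sum0.
  have : (a n)%:num%:E * Q n A <= 0.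
    rewrite -[leRHS]sum0 leeDl//; apply: nneseries_ge0 => k _ _.
    by rewrite mule_ge0.
  by rewrite pmule_rle0 ?lte_fin// => QA0; apply/eqP; rewrite eq_le QA0 measure_ge0.
split.
- have Nex n : exists N : set (borel (curve R X)), [/\ measurable N, Q n N = 0 &
      ~` [set g | abs_continuous (g : curve R X)] `<=` N].
    by have [[N [mN N0 ?]] _ _] := Qtp n; exists N.
  have [N HN] := choice Nex.
  have mN : measurable (\bigcap_n N n) by apply: bigcapT_measurable => n; case: (HN n).
  exists (\bigcap_n N n); split => //.
    apply: PE0 => // n; have [mNn Nn0 _] := HN n.
    by apply: subset_measure0 Nn0 => //; exact: bigcap_inf.
  by move=> g ng n _; have [_ _] := HN n; apply.
- exists K => // t t01 A mA.
  rewrite /pushforward PE; last first.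
    by rewrite -[X in measurable X]setTI; exact: measurable_evalc.
  apply: (@le_trans _ _ (\sum_(n <oo) m A * (K / (2 ^ n.+1)%:R)%:E)).
    apply: lee_nneseries => n _; first by move=> _; rewrite mule_ge0.
    have [Cn0 HCn] := HC n.
    apply: (@le_trans _ _ ((a n)%:num%:E * ((C n)%:E * m A))).
      by rewrite lee_wpmul2l// HCn.
    rewrite muleA muleC lee_wpmul2l// -EFinM lee_fin (le_trans _ (aK n))//.
    by rewrite ler_wpM2l// lerDl.
  have [mAy|mAy] := eqVneq (m A) +oo.
    by rewrite mAy gt0_muley ?lte_fin// leey.
  have mAfin : m A \is a fin_num by rewrite ge0_fin_numE// lt_neqAle mAy leey.
  rewrite -(fineK mAfin) nneseriesZl; last by move=> n _; rewrite lee_fin.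
  rewrite [leRHS]muleC lee_wpmul2l ?lee_fin ?fine_ge0//.
  exact: epsilon_trick0 xpredT (ltW K0).
- apply: (@le_lt_trans _ _ K%:E); last exact: ltry.
  apply: (le_trans (ge0_integral_le_mixture F0 PE)).
  apply: le_trans (epsilon_trick0 xpredT (ltW K0)).
  apply: lee_nneseries => n _; first by move=> _; rewrite mule_ge0// integral_ge0.
  rewrite eE -EFinM lee_fin (le_trans _ (aK n))// ler_wpM2l// lerDr ltW//.
  by have [] := HC n.
Qed.

End mixture_of_test_plans.

(** * Existence of a test plan *)

Section constant_curves.
Import HBNNSimple.
Context {R : realType} {X : completeMetricType R}.
Variables (m : {measure set (borel X) -> \bar R}) (q : R).

Definition const_curve (x : X) : curve R X :=
  mkcts (@cst_continuous (unit_interval R) X x).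

Lemma evalc_const_curve t x : evalc t (const_curve x) = x.
Proof. by []. Qed.

Lemma measurable_const_curve :
  measurable_fun setT (const_curve : borel X -> borel (curve R X)).
Proof.
apply: (@measurability _ _ (borel X) (borel (curve R X)) setT _ (@open (curve R X))) => //.
move=> _ [U oU <-]; rewrite setTI; apply: measurable_open_borel.
apply: open_comp => // x _.
have FF : Filter (nbhs x) := nbhs_filter x.
apply/(@metricType_numDomainType.cvgrPdist_lt _ _ _ (nbhs x) FF) => e e0.
apply/metricType_numDomainType.nbhs_mdistP; exists e => //= y xy.
by apply: le_lt_trans xy; apply: dsup_le.
Qed.

Lemma diff_quotient_const_curve x t : diff_quotient (const_curve x) t = cst 0.
Proof.
by apply/funext => h; rewrite /diff_quotient !evalc_const_curve mdistxx mul0r.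
Qed.

Lemma metric_speed_const_curve x t : metric_speed (const_curve x) t = 0.
Proof.
by rewrite /metric_speed diff_quotient_const_curve; apply/cvg_lim => //; exact: cvg_cst.
Qed.

Lemma abs_continuous_const_curve x : abs_continuous (const_curve x).
Proof.
have speedE : metric_speed (const_curve x) = cst 0.
  by apply/funext => t; exact: metric_speed_const_curve.
split.
- apply: aeW => t _; rewrite diff_quotient_const_curve; exact: is_cvg_cst.
- by rewrite speedE; exact: integrable0.
- move=> s t _ _ _; rewrite !evalc_const_curve mdistxx.
  by apply: integral_ge0 => r _; rewrite metric_speed_const_curve.
Qed.

Lemma ex_ball_measure_gt0 : (0 < m setT)%E ->
  exists n : nat, (0 < m (ball (point : X) n%:R))%E.
Proof.
move=> mT; apply: contrapT => /forallNP mB.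
have mball (n : nat) : (measurable : set (set (borel X))) (ball (point : X) (n%:R : R)).
  by apply: measurable_open_borel; exact: open_metric_ball.
have : m.-negligible (\bigcup_n ball (point : X) (n%:R : R)).
  apply: negligible_bigcup => n; apply/negligibleP; first exact: mball.
  apply/eqP; rewrite eq_le measure_ge0 andbT leNgt; apply/negP; exact: mB.
rewrite (_ : \bigcup_n _ = setT); last first.
  apply/seteqP; split=> // x _.
  exists (Num.truncn (mdist (point : X) x)).+1 => //.
  by rewrite ballEmdist/= truncnS_gt.
by move=> /(negligibleP _ measurableT) mT0; rewrite mT0 ltxx in mT.
Qed.

(** The constant curves, with starting point distributed along m restricted to
    a ball of positive measure and normalized. *)
Lemma ex_test_plan : metric_measure_space m -> (0 < m setT)%E -> 1 < q ->
  exists P : plan X, test_plan m q P.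
Proof.
move=> [_ mfin] mT q1; have [n Bn] := ex_ball_measure_gt0 mT.
have mB : (measurable : set (set (borel X))) (ball (point : X) (n%:R : R)).
  by apply: measurable_open_borel; exact: open_metric_ball.
have Blty : (m (ball (point : X) n%:R) < +oo)%E.
  by apply: mfin => //; exists point, n%:R.
pose c : borel X -> borel (curve R X) := const_curve.
pose P0 : plan X := mnormalize (pushforward (mrestr m mB) c)
  (\d_ (point : borel (curve R X))).
pose P := P0 measurable_const_curve.
pose k := (fine (m (ball (point : X) n%:R)))^-1.
have k0 : 0 < k by rewrite invr_gt0 fine_gt0// Bn.
have PE A : P A = (k%:E * m (const_curve @^-1` A `&` ball (point : X) n%:R))%E.
  have BB : (0 < m (ball (point : X) (n%:R : R)) < +oo)%E by rewrite Bn.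
  have := @mnormalizeE _ _ _ (pushforward (mrestr m mB) c) (\d_ point) _ A _ BB.
  move=> e; apply: (etrans (e measurable_const_curve _)) => //.
  by rewrite -[LHS]/(m (setT `&` ball (point : X) (n%:R : R))) setTI.
(* the nonconstant curves, an open set *)
pose N : set (borel (curve R X)) :=
  \bigcup_(t in [set: R]) [set g | 0 < mdist (evalc t g) (evalc 0 g)].
have mN : measurable N.
  apply: measurable_open_borel; apply: bigcup_open => t _.
  rewrite openE => g /= gt0.
  apply/metricType_numDomainType.nbhs_mdistP.
  exists (mdist (evalc t g) (evalc 0 g) / 2) => [|h /= gh]; first exact: divr_gt0.
  have := metric_triangle (evalc t g) (evalc t h) (evalc 0 g).
  have := metric_triangle (evalc t h) (evalc 0 h) (evalc 0 g).
  have := mdist_evalc_le t g h; have := mdist_evalc_le 0 g h.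
  rewrite (metric_sym (evalc 0 h)) => ? ? ? ?.
  rewrite ltNge; apply/negP => ?; move: gh; rewrite ltr_pdivlMr//; lra.
have PN0 : P N = 0%E.
  rewrite PE (_ : _ `&` _ = set0) ?measure0 ?mule0//.
  apply/seteqP; split=> // x [[t _ /=]].
  by rewrite -[X in 0 < X -> _]/(mdist x x) mdistxx ltxx.
have notN g : ~ N g -> g = const_curve (evalc 0 g).
  move=> Ng; apply/continuousEP => t.
  have tE : t = unit_pt (set_val t).
    apply: val_inj => /=; rewrite clamp01_id//.
    by have := set_valP t; rewrite /unit_interval/= in_itv.
  apply: contrapT => ne; apply: Ng; exists (set_val t) => //=.
  rewrite mdist_gt0; apply/eqP; rewrite /evalc -tE; exact: ne.
exists P; split.
- exists N; split => // g /= nac; apply: contrapT => /notN gE; apply: nac.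
  by rewrite gE; exact: abs_continuous_const_curve.
- exists k => // t t01 A mA; rewrite /pushforward PE lee_wpmul2l//; first by rewrite lee_fin ltW.
  rewrite -[leLHS]/(m (A `&` ball (point : X) n%:R)).
  by apply: le_measure; rewrite ?inE//; exact: measurableI.
- rewrite ge0_integralTE; last first.
    by move=> g; apply: integral_ge0 => t _; rewrite lee_fin powR_ge0.
  apply: (@le_lt_trans _ _ 0%E) => //; apply: ge_ereal_sup => _ [h hF <-].
  rewrite -integralT_nnsfun (@ae_eq_integral _ _ _ P setT (cst 0%E)) ?integral0//.
    by apply/measurable_EFinP; exact: measurable_funP.
  exists N; split => // g /= hg; apply: contrapT => /notN gE; apply: hg => _.
  have hg0 : 0 <= h g by [].
  apply/eqP; rewrite eq_le; apply/andP; split; last by rewrite lee_fin.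
  rewrite (le_trans (hF g))// gE.
  rewrite integral0_eq// => t _; rewrite metric_speed_const_curve powR0//.
  by rewrite gt_eqF// (lt_trans _ q1).
Qed.

End constant_curves.

(** * Master test plans *)

Section master_plans.
Context {R : realType} {X : completeMetricType R}.
Variables (m : {measure set (borel X) -> \bar R}) (p q : R).
Hypothesis p1 : 1 < p.
Implicit Types (f g : X -> R) (P Q : plan X).

Local Notation wug := (weak_upper_gradient m).
Local Notation along P f := (min_weak_upper_gradient m [set P] p f).
Local Notation full f := (min_weak_upper_gradient m (test_plans m q) p f).
Local Notation Lp := (@Lfun _ (borel X) R m p%:E).

Let p_ge1 : 1 <= p. Proof. exact: ltW. Qed.

Lemma set1_test_plans P : test_plan m q P -> [set P] `<=` test_plans m q.
Proof. by move=> tP _ ->. Qed.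

Lemma full_wug f : sobolev m p q f -> wug (test_plans m q) p f (full f).
Proof. by move=> [_ wf]; have [] := min_wugP p1 (@subset_refl _ (test_plans m q)) wf. Qed.

Lemma full_min f G : wug (test_plans m q) p f G -> \forall x \ae m, full f x <= G x.
Proof.
move=> wG; have [_] := min_wugP p1 (@subset_refl _ (test_plans m q)) (ex_intro _ _ wG).
exact.
Qed.

Lemma along_wug P f G : test_plan m q P -> wug [set P] p f G ->
  wug [set P] p f (along P f).
Proof.
by move=> /set1_test_plans tP wG; have [] := min_wugP p1 tP (ex_intro _ _ wG).
Qed.

Lemma along_min P f G : test_plan m q P -> wug [set P] p f G ->
  \forall x \ae m, along P f x <= G x.
Proof.
by move=> /set1_test_plans tP wG; have [_] := min_wugP p1 tP (ex_intro _ _ wG); exact.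
Qed.

Lemma sobolev_wug1 P f : test_plan m q P -> sobolev m p q f ->
  wug [set P] p f (along P f).
Proof.
move=> tP /full_wug wf; apply: (along_wug tP).
exact: wug_mono (set1_test_plans tP) wf.
Qed.

Lemma along_le_full P f : test_plan m q P -> sobolev m p q f ->
  \forall x \ae m, along P f x <= full f x.
Proof.
move=> tP /full_wug wf; apply: (along_min tP).
exact: wug_mono (set1_test_plans tP) wf.
Qed.

(** The larger a plan for absolute continuity, the larger its minimal weak
    upper gradients; this makes mixtures upper bounds of their components. *)
Lemma along_dominated P Q f : test_plan m q P -> test_plan m q Q ->
  (forall A, measurable A -> P A = 0%E -> Q A = 0%E) -> sobolev m p q f ->
  \forall x \ae m, along Q f x <= along P f x.
Proof.
move=> tP tQ dom sf; apply: (along_min tQ).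
exact: wug_dominated dom (sobolev_wug1 tP sf).
Qed.

(** The plan P of largest energy is a master plan for f: mixing it with any
    test plan Q does not raise the energy, hence leaves its minimal weak upper
    gradient unchanged, which is therefore a weak upper gradient along Q. *)
Lemma ex_master_single f : (exists P : plan X, test_plan m q P) ->
  sobolev m p q f ->
  exists2 P, test_plan m q P & \forall x \ae m, along P f x = full f x.
Proof.
move=> [P0 tP0] sf.
pose T := {P : plan X | test_plan m q P}.
pose J (t : T) := Lp_energy m p (along (sval t) f).
have Lfull : full f \in Lp by have [] := full_wug sf.
have Lalong P : test_plan m q P -> along P f \in Lp.
  by move=> tP; have [] := sobolev_wug1 tP sf.
have along0 P : test_plan m q P -> \forall x \ae m, 0 <= along P f x.
  by move=> tP; have [] := sobolev_wug1 tP sf.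
have energy_le P (G : X -> R) : test_plan m q P -> G \in Lp ->
    (\forall x \ae m, along P f x <= G x) ->
    Lp_energy m p (along P f) <= Lp_energy m p G.
  move=> tP LG le; apply: le_Lp_energy => //; first exact: Lalong.
  move: (along0 _ tP) le; apply: ae_imp2 => x a0 le.
  by rewrite !ger0_norm// (le_trans a0).
have JM t : J t <= Lp_energy m p (full f).
  by apply: energy_le => //; [exact: svalP|apply: along_le_full => //; exact: svalP].
have dir (s : nat -> T) : exists t, forall n, J (s n) <= J t.
  have [P tP dom] := mixture_test_plan (fun n => svalP (s n)).
  exists (exist _ P tP) => n; apply: energy_le; [exact: svalP|exact: Lalong|].
  by apply: along_dominated => //; [exact: svalP|exact: dom].
have [[P tP] maxJ] := countably_directed_max (exist _ P0 tP0) JM dir.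
exists P => //.
have wP : wug (test_plans m q) p f (along P f).
  have [LP P_ge0 _] := sobolev_wug1 tP sf.
  split => // Q tQ.
  (* the mixture of P and Q, as the mixture of the sequence P, Q, Q, ... *)
  pose s n : plan X := if n is 0%N then P else Q.
  have ts n : test_plan m q (s n) by case: n.
  have [P' tP' dom] := mixture_test_plan ts.
  have eqP' : \forall x \ae m, along P' f x = along P f x.
    have := maxJ (exist _ P' tP'); rewrite /J/= => energy.
    have : \forall x \ae m, along P f x = along P' f x.
      apply: (Lp_energy_rigidity p_ge1 _ _ _ energy); [exact: Lalong|exact: Lalong|].
      move: (along0 _ tP) (along_dominated tP' tP (dom 0%N) sf).
      by apply: ae_imp2 => x -> ->.
    by apply: ae_imp => x ->.
  have wP' := wug_ae_eq p1 (set1_test_plans tP') (sobolev_wug1 tP' sf)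
    (Lfun_measurable LP) eqP'.
  by have [_ _ /(_ Q erefl)] := wug_dominated (dom 1%N) wP'.
move: (along_le_full tP sf) (full_min wP).
by apply: ae_imp2 => x le1 le2; apply/eqP; rewrite eq_le le1 le2.
Qed.

Lemma sobolevB f g : sobolev m p q f -> sobolev m p q g ->
  sobolev m p q (fun x => f x - g x).
Proof.
move=> [Lf [F wF]] [Lg [G wG]]; split; last first.
  by exists (fun x => F x + G x); exact: wugB.
have p1E : (1 <= p%:E)%E by rewrite lee_fin.
apply: (Lfun_addr_closed m p1E).2 => //.
exact: (Lfun_oppr_closed (p := p%:E)).
Qed.

(** Two triangle inequalities, f = (f - g) + g along all the test plans and
    g = f - (f - g) along P, linked by the equality for g. *)
Lemma full_sub_along_le P f g : test_plan m q P ->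
  sobolev m p q f -> sobolev m p q g ->
  (\forall x \ae m, along P g x = full g x) ->
  \forall x \ae m, full f x - along P f x <= 2 * full (fun y => f y - g y) x.
Proof.
move=> tP sf sg gm; have sfg := sobolevB sf sg.
have le1 : \forall x \ae m, full f x <= full (fun y => f y - g y) x + full g x.
  apply: full_min; rewrite (_ : f = fun x => (f x - g x) - (- g x)); last first.
    by apply/funext => x; rewrite opprK subrK.
  under [fun y => f y - g y - - g y - g y]eq_fun do rewrite opprK subrK.
  by apply: wugB => //; [exact: full_wug|apply: wugN; exact: full_wug].
have le2 : \forall x \ae m, along P g x <= along P f x + along P (fun y => f y - g y) x.
  apply: (along_min tP).
  have := wugB p1 (sobolev_wug1 tP sf) (sobolev_wug1 tP sfg).
  by under [fun y => f y - (f y - g y)]eq_fun do rewrite subKr.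
have le3 := along_le_full tP sfg.
move: le1 (ae_imp2 (fun x => @conj _ _) gm (ae_imp2 (fun x => @conj _ _) le2 le3)).
apply: ae_imp2 => x + [-> [+ +]].
by move: (full f x) (full g x) (full _ x) (along P f x) (along P _ x) => *; lra.
Qed.

Lemma sobolev_norm_energy f (e : R) : 0 < e -> sobolev m p q f ->
  (sobolev_norm m p q f < e%:E)%E -> Lp_energy m p (full f) <= e `^ p.
Proof.
move=> e0 sf norm_lt; have [Lfull _ _] := full_wug sf.
rewrite -lee_fin /Lp_energy /Rintegral fineK; last first.
  exact: integrable_fin_num (Lfun_integrable p_ge1 Lfull).
by apply: (poweR_root_lt p_ge1) norm_lt => //; apply: integral_ge0 => x _; rewrite lee_fin powR_ge0.
Qed.

(** The defect h = |Df| - |Df|_P is at most 2 |D(f - g)| for all the g of the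
    approximating set, so its energy vanishes. *)
Lemma master_closure P f : test_plan m q P -> sobolev m p q f ->
  (forall e : R, 0 < e -> exists2 g, sobolev m p q g /\
     (\forall x \ae m, along P g x = full g x) &
     (sobolev_norm m p q (fun x => (f x - g x)%R) < e%:E)%E) ->
  \forall x \ae m, along P f x = full f x.
Proof.
move=> tP sf approx.
have p0 : 0 < p by rewrite (lt_trans _ p1).
have p1E : (1 <= p%:E)%E by rewrite lee_fin.
pose h x := full f x - along P f x.
have [Lfull _ _] := full_wug sf; have [Lalong _ _] := sobolev_wug1 tP sf.
have Lh : h \in Lp.
  by apply: (Lfun_addr_closed m p1E).2 => //; exact: (Lfun_oppr_closed (p := p%:E)).
have h0 : \forall x \ae m, 0 <= h x.
  by move: (along_le_full tP sf); apply: ae_imp => x; rewrite subr_ge0.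
have energy_h0 : Lp_energy m p h <= 0.
  apply/ler_addgt0Pl => d d0; rewrite addr0.
  (* chosen so that (2 e)^p = d *)
  pose e := d `^ p^-1 / 2.
  have e0 : 0 < e by rewrite divr_gt0// powR_gt0.
  have [g [sg gm] fg] := approx e e0.
  have sfg := sobolevB sf sg; have [LD D0 _] := full_wug sfg.
  pose D := full (fun x => f x - g x).
  have L2D : (fun x => 2 * D x) \in Lp.
    rewrite (_ : (fun _ => _) = 2 \o* D); first exact: Lfun_scale.
    by apply/funext => x; rewrite /= mulrC.
  apply: (@le_trans _ _ (Lp_energy m p (fun x => 2 * D x))).
    apply: le_Lp_energy => //.
    move: h0 (full_sub_along_le tP sf sg gm); apply: ae_imp2 => x hx0 hx.
    by rewrite !ger0_norm// (le_trans hx0).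
  rewrite (Lp_energyZ p_ge1)//; apply: (@le_trans _ _ (2 `^ p * e `^ p)).
    by rewrite ler_wpM2l ?powR_ge0// sobolev_norm_energy.
  rewrite -powRM ?(ltW e0)// /e mulrC divfK// -powRrM mulVf ?gt_eqF//.
  by rewrite powRr1// ltW.
have L0 : (cst 0 : X -> R) \in Lp by exact: (Lfun_addr_closed m p1E).1.
have : \forall x \ae m, cst 0 x = h x.
  apply: (Lp_energy_rigidity p_ge1 L0 Lh).
    by move: h0; apply: ae_imp => x ->; rewrite lexx.
  apply: (le_trans energy_h0); apply: Rintegral_ge0 => x _; exact: powR_ge0.
by apply: ae_imp => x /= /esym/eqP; rewrite subr_eq0 => /eqP.
Qed.

(** A mixture of master plans for the elements of a countable dense set; these
    are indexed by an injection phi of the dense set into the integers. *)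
Lemma ex_master_test_plan (S : set (X -> R)) :
  (exists P : plan X, test_plan m q P) ->
  S `<=` sobolev m p q -> sobolev_separable m p q S ->
  exists P : plan X, master_test_plan m p q S P.
Proof.
move=> exP Ssob [D [cD DS] dense].
have [phi inj] := countable_injP _ cD.
have Qex n : exists Q, test_plan m q Q /\ forall g, D g -> phi g = n ->
    \forall x \ae m, along Q g x = full g x.
  have [[g [Dg gn]]|no] := pselect (exists g, D g /\ phi g = n).
    have [Q tQ HQ] := ex_master_single exP (Ssob _ (DS _ Dg)).
    exists Q; split => // h Dh hn.
    rewrite (_ : h = g); first exact: HQ.
    by apply: inj; [exact: mem_set|exact: mem_set|rewrite hn gn].
  have [P0 tP0] := exP; exists P0; split => // g Dg gn.
  by exfalso; apply: no; exists g.
have [Q HQ] := choice Qex.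
have [P tP dom] := mixture_test_plan (fun n => (HQ n).1).
exists P; split; first exact: set1_test_plans.
move=> f Sf.
suff : \forall x \ae m, along P f x = full f x by apply: ae_imp => x ->.
apply: master_closure => // [|e e0]; first exact: Ssob.
have [g Dg fg] := dense f Sf e e0.
exists g => //; have sg := Ssob _ (DS _ Dg); split => //.
have [tQ /(_ g Dg erefl) Qg] := HQ (phi g).
move: (along_le_full tP sg) (ae_imp2 (fun x => @conj _ _) Qg
  (along_dominated tP tQ (dom (phi g)) sg)).
by apply: ae_imp2 => x le1 [e1 le2]; apply/eqP; rewrite eq_le le1 -e1 le2.
Qed.

End master_plans.

Theorem theorem4 (R : realType) (X : completeMetricType R)
    (m : {measure set (borel X) -> \bar R}) (p q : R) :
  metric_measure_space m -> (0 < m setT)%E ->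
  1 < p -> 1 < q -> p^-1 + q^-1 = 1 ->
  (forall S : set (X -> R), S `<=` sobolev m p q -> sobolev_separable m p q S ->
    exists pi : plan X, master_test_plan m p q S pi) /\
  (sobolev_separable m p q (sobolev m p q) ->
    exists pi : plan X, master_test_plan m p q (sobolev m p q) pi).
Proof.
move=> mms mT p1 q1 _; have exP := ex_test_plan mms mT q1.
split=> [S Ssob Ssep|Ssep]; first exact: ex_master_test_plan.
exact: ex_master_test_plan.
Qed.
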